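(* Let $n\ge1$, $\mu,\lambda^*\in\mathbb{R}$, and $\nu\in\mathbb{R}^n$. For every $\beta\le n+2$, $$\lim_{\delta\to0^+}M_b(\nu)=-\mu\|\nu\|^2I-2\mu\,\nu\otimes\nu,\qquad \lim_{\delta\to0^+}M_s(\nu)=-(\lambda^*-\mu)\,\nu\otimes\nu,$$ $$\lim_{\delta\to0^+}M^{\delta,\beta}(\nu)=-(\lambda^*+\mu)\,\nu\otimes\nu-\mu\|\nu\|^2I=M^{\mathcal N}(\nu).$$ Moreover, for every $\delta>0$, $$\lim_{\beta\to (n+2)^-}M_b(\nu)=-\mu\|\nu\|^2I-2\mu\,\nu\otimes\nu,\qquad \lim_{\beta\to (n+2)^-}M_s(\nu)=-(\lambda^*-\mu)\,\nu\otimes\nu,$$ $$\lim_{\beta\to (n+2)^-}M^{\delta,\beta}(\nu)=-(\lambda^*+\mu)\,\nu\otimes\nu-\mu\|\nu\|^2I=M^{\mathcal N}(\nu).$$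
   Context: $B_\delta(0)$ is the ball of radius $\delta$ centered at $0$ in $\mathbb{R}^n$; $v\otimes w$ is the matrix with entries $v_iw_j$; $I$ is the $n\times n$ identity matrix. For $\delta>0$ and $\beta<n+2$, with $$c^{\delta,\beta}=\left(\frac{1}{2n}\int_{B_\delta(0)}\frac{\|w\|^2}{\|w\|^\beta}\,dw\right)^{-1}=\frac{2(n+2-\beta)\Gamma\left(\frac n2+1\right)}{\pi^{n/2}\delta^{n+2-\beta}},$$ the multipliers of the linear peridynamic operator are $M^{\delta,\beta}=M_b+M_s$, where ($M_b$, $M_s$ depend on $\delta,\beta$) $$M_b(\nu)=(n+2)\,\mu\,c^{\delta,\beta}\int_{B_\delta(0)}\frac{w\otimes w}{\|w\|^{\beta+2}}\big(\cos(\nu\cdot w)-1\big)\,dw,$$ $$M_s(\nu)=-(\lambda^*-\mu)\frac{(c^{\delta,\beta})^2}{4}\left(\int_{B_\delta(0)}\frac{w}{\|w\|^\beta}\sin(\nu\cdot w)\,dw\right)\otimes\left(\int_{B_\delta(0)}\frac{w}{\|w\|^\beta}\sin(\nu\cdot w)\,dw\right).$$ For $\beta=n+2$, $M_b$ and $M_s$ are defined by their hypergeometric formulas $$M_b(\nu)=-\mu\|\nu\|^2\,{}_2F_3\left(1,\tfrac{n+2-\beta}{2};2,\tfrac{n+4}{2},\tfrac{n+4-\beta}{2};-\tfrac14\|\nu\|^2\delta^2\right)I-2\mu\,{}_1F_2\left(\tfrac{n+2-\beta}{2};\tfrac{n+4}{2},\tfrac{n+4-\beta}{2};-\tfrac14\|\nu\|^2\delta^2\right)\nu\otimes\nu,$$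 $$M_s(\nu)=-(\lambda^*-\mu)\,{}_1F_2\left(\tfrac{n+2-\beta}{2};\tfrac{n+2}{2},\tfrac{n+4-\beta}{2};-\tfrac14\|\nu\|^2\delta^2\right)^2\nu\otimes\nu,$$ where ${}_pF_q(a_1,\dots,a_p;b_1,\dots,b_q;z)=\sum_{k\ge0}\frac{(a_1)_k\cdots(a_p)_k}{(b_1)_k\cdots(b_q)_k}\frac{z^k}{k!}$ and $(a)_k=a(a+1)\cdots(a+k-1)$. The multiplier of the Navier operator $\mathcal N\mathbf u=(\lambda^*+\mu)\nabla(\nabla\cdot\mathbf u)+\mu\Delta\mathbf u$ is $M^{\mathcal N}(\nu)=-(\lambda^*+\mu)\,\nu\otimes\nu-\mu\|\nu\|^2I$. *)

(* Defs.v *)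
From HB Require Import structures.
From mathcomp Require Import all_boot all_order all_algebra.
From mathcomp Require Import all_classical all_reals all_analysis.

Set Implicit Arguments.
Unset Strict Implicit.
Unset Printing Implicit Defensive.
Import Order.TTheory GRing.Theory Num.Theory.
Import numFieldNormedType.Exports.

Local Open Scope classical_set_scope.
Local Open Scope ring_scope.

Definition cons_pair (T : Type) (n : nat) (x : T * n.-tuple T) : n.+1.-tuple T :=
  [tuple of x.1 :: x.2].

(* Lebesgue measure on the Borel sets of R^n: the image of the n-fold product
   of [lebesgue_measure] (a point mass when n = 0). *)
Fixpoint lebesgue_tuple (R : realType) (n : nat) :
    set (n.-tuple (measurableTypeR R)) -> \bar R :=
  match n with
  | 0 => dirac [tuple]
  | m.+1 => pushforward (@lebesgue_measure R \x @lebesgue_tuple R m)%E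
              (@cons_pair (measurableTypeR R) m)
  end.
Arguments lebesgue_tuple {R} n _.

Section lebesgue_tuple_instances.
Context {R : realType}.
Local Notation T := (measurableTypeR R).

Lemma measurable_cons_pair n : measurable_fun setT (@cons_pair T n).
Proof. exact: measurable_cons. Qed.

Lemma cons_pairK n (x : T * n.-tuple T) :
  (thead (cons_pair x), [tuple of behead (cons_pair x)]) = x.
Proof. by case: x => x t; congr pair; apply/val_inj. Qed.

Lemma sigma_finite_cons_pair n (m1 : {sigma_finite_measure set T -> \bar R})
    (m2 : {sigma_finite_measure set (n.-tuple T) -> \bar R}) :
  exists m : {sigma_finite_measure set (n.+1.-tuple T) -> \bar R},
    (m : set _ -> _) = pushforward (m1 \x m2)%E (@cons_pair T n).
Proof.
pose q : {measure set (n.+1.-tuple T) -> \bar R} :=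
  measure_function_pushforward__canonical__measure_function_Measure
    (m1 \x m2)%E (@measurable_cons_pair n).
have sfq : sigma_finite setT q.
  have /sigma_finiteP[F [TF ndF Foo]] := sigma_finiteT m1.
  have /sigma_finiteP[G [TG ndG Goo]] := sigma_finiteT m2.
  pose g (t : n.+1.-tuple T) : T * n.-tuple T := (thead t, [tuple of behead t]).
  have mg : measurable_fun setT g.
    by apply/measurable_fun_pair;
      [exact: measurable_tnth|exact: measurable_behead].
  exists (fun k => g @^-1` (F k `*` G k)).
    apply/seteqP; split => // t _.
    have [i _ Fi] : (\bigcup_k F k) (thead t) by rewrite -TF.
    have [j _ Gj] : (\bigcup_k G k) [tuple of behead t] by rewrite -TG.
    exists (maxn i j) => //; split => /=.
      by move: Fi; exact/subsetPset/ndF/leq_maxl.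
    by move: Gj; exact/subsetPset/ndG/leq_maxr.
  move=> k; have [mF Fk] := Foo k; have [mG Gk] := Goo k; split.
    by rewrite -[X in measurable X]setTI; apply: mg => //; exact: measurableX.
  have -> : q (g @^-1` (F k `*` G k)) = (m1 \x m2)%E (F k `*` G k).
    rewrite /q/= /pushforward/=; congr ((m1 \x m2)%E _).
    by rewrite -comp_preimage (_ : g \o _ = id)//; apply/funext/cons_pairK.
  by rewrite product_measure1E// lte_mul_pinfty// ge0_fin_numE.
pose s : {sigma_finite_measure set (n.+1.-tuple T) -> \bar R} :=
  HB.pack (Measure.sort q) (Measure_isSigmaFinite.Build _ _ _ (Measure.sort q) sfq).
by exists s.
Qed.

Lemma sigma_finite_lebesgue_tuple n :
  exists m : {sigma_finite_measure set (n.-tuple T) -> \bar R},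
    (m : set _ -> _) = lebesgue_tuple n.
Proof.
elim: n => [|n [m mE]]; first by exists (dirac ([tuple] : 0.-tuple T)).
have [m' m'E] := sigma_finite_cons_pair (@lebesgue_measure R) m.
by exists m'; rewrite m'E /= mE.
Qed.

Let lebesgue_tuple0 n : @lebesgue_tuple R n set0 = 0%E.
Proof. by have [m <-] := sigma_finite_lebesgue_tuple n; rewrite measure0. Qed.

Let lebesgue_tuple_ge0 n A : (0 <= @lebesgue_tuple R n A)%E.
Proof. by have [m <-] := sigma_finite_lebesgue_tuple n; rewrite measure_ge0. Qed.

Let lebesgue_tuple_semi_sigma_additive n :
  semi_sigma_additive (@lebesgue_tuple R n).
Proof.
have [m <-] := sigma_finite_lebesgue_tuple n.
exact: measure_semi_sigma_additive.
Qed.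

HB.instance Definition _ n := isMeasure.Build _ _ _ (@lebesgue_tuple R n)
  (lebesgue_tuple0 n) (@lebesgue_tuple_ge0 n)
  (@lebesgue_tuple_semi_sigma_additive n).

Let lebesgue_tuple_sigma_finite n : sigma_finite setT (@lebesgue_tuple R n).
Proof.
by have [m <-] := sigma_finite_lebesgue_tuple n; exact: sigma_finiteT.
Qed.

HB.instance Definition _ n := Measure_isSigmaFinite.Build _ _ _
  (@lebesgue_tuple R n) (lebesgue_tuple_sigma_finite n).

Lemma lebesgue_tuple_box n (A : 'I_n -> set T) :
  (forall i, measurable (A i)) ->
  lebesgue_tuple n [set t | forall i, A i (tnth t i)] =
  (\prod_(i < n) lebesgue_measure (A i))%E.
Proof.
elim: n A => [|n IHn] A mA.
  by rewrite big_ord0 /= diracE mem_set// => -[].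
rewrite big_ord_recl -(IHn (fun i => A (lift ord0 i)))//.
have [m mE] := sigma_finite_lebesgue_tuple n.
rewrite /= -mE -product_measure1E//; last first.
  have -> : [set t : n.-tuple T | forall i, A (lift ord0 i) (tnth t i)] =
      \bigcap_(i in [set: 'I_n]) ((@tnth n T)^~ i @^-1` A (lift ord0 i)).
    by apply/seteqP; split=> t /= At i => [_|]; [exact: At|exact: (At i I)].
  apply: fin_bigcap_measurable => // i _.
  by rewrite -[X in measurable X]setTI; exact: measurable_tnth.
rewrite /pushforward; congr ((_ \x _)%E _).
apply/seteqP; split=> -[x t] /= => [At|[Ax At] i].
  by split=> [|i]; [exact: (At ord0)|move: (At (lift ord0 i)); rewrite tnthS].
case: (unliftP ord0 i) => [j ->|->]; last exact: Ax.
by rewrite tnthS; exact: At.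
Qed.

End lebesgue_tuple_instances.

Section vectors.
Context {R : realType}.

Definition dotv n (v w : 'rV[R]_n) : R := \sum_(i < n) v 0 i * w 0 i.

(* The norm of ['rV[R]_n] provided by the library is the sup norm. *)
Definition enorm n (v : 'rV[R]_n) : R := Num.sqrt (dotv v v).

Definition tensorv n (v w : 'rV[R]_n) : 'M[R]_n := \matrix_(i, j) (v 0 i * w 0 j).

Definition eball n (delta : R) : set 'rV[R]_n := [set w | enorm w < delta].

Definition row_of_tuple n (t : n.-tuple R) : 'rV[R]_n := \row_i tnth t i.

Definition rV_integral n (D : set 'rV[R]_n) (f : 'rV[R]_n -> R) : R :=
  \int[lebesgue_tuple n]_(t in [set t | D (row_of_tuple t)]) f (row_of_tuple t).

Definition mx_integral n p q (D : set 'rV[R]_n) (F : 'rV[R]_n -> 'M[R]_(p, q)) :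
    'M[R]_(p, q) :=
  \matrix_(i, j) rV_integral D (fun w => F w i j).

End vectors.
Arguments eball {R} n delta.

Section hypergeometric.
Context {R : realType}.

Definition pochhammer (a : R) (k : nat) : R := \prod_(i < k) (a + i%:R).

Definition hypergeometric (a b : seq R) (z : R) : R :=
  limn (series (fun k : nat =>
    (\prod_(x <- a) pochhammer x k) / (\prod_(y <- b) pochhammer y k) *
    (z ^+ k / k`!%:R))).

End hypergeometric.

Section multipliers.
Context {R : realType} (n : nat).
Implicit Types (mu lambda delta beta : R) (nu : 'rV[R]_n).

Definition scaling_constant delta beta : R :=
  ((2 * n%:R)^-1 *
   rV_integral (eball n delta) (fun w => enorm w ^+ 2 / enorm w `^ beta))^-1.

Definition Mb_int mu delta beta nu : 'M[R]_n :=
  ((n%:R + 2) * mu * scaling_constant delta beta) *: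
  mx_integral (eball n delta) (fun w =>
    ((cos (dotv nu w) - 1) / enorm w `^ (beta + 2)) *: tensorv w w).

Definition Ms_int mu lambda delta beta nu : 'M[R]_n :=
  let s : 'rV[R]_n := mx_integral (eball n delta) (fun w =>
    (sin (dotv nu w) / enorm w `^ beta) *: w) in
  (- (lambda - mu) * (scaling_constant delta beta ^+ 2 / 4)) *: tensorv s s.

Definition Mb_hyp mu delta beta nu : 'M[R]_n :=
  let z := - (4^-1 * enorm nu ^+ 2 * delta ^+ 2) in
  (- mu * enorm nu ^+ 2 *
     hypergeometric [:: 1; (n%:R + 2 - beta) / 2]
       [:: 2; (n%:R + 4) / 2; (n%:R + 4 - beta) / 2] z) *: 1%:M
  - (2 * mu *
     hypergeometric [:: (n%:R + 2 - beta) / 2]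
       [:: (n%:R + 4) / 2; (n%:R + 4 - beta) / 2] z) *: tensorv nu nu.

Definition Ms_hyp mu lambda delta beta nu : 'M[R]_n :=
  let z := - (4^-1 * enorm nu ^+ 2 * delta ^+ 2) in
  (- (lambda - mu) *
     hypergeometric [:: (n%:R + 2 - beta) / 2]
       [:: (n%:R + 2) / 2; (n%:R + 4 - beta) / 2] z ^+ 2) *: tensorv nu nu.

(* The integrals are the definition when beta < n + 2, where they converge; at
   the critical value beta = n + 2 the hypergeometric expressions are. *)
Definition Mb mu delta beta nu : 'M[R]_n :=
  if beta < n%:R + 2 then Mb_int mu delta beta nu else Mb_hyp mu delta beta nu.

Definition Ms mu lambda delta beta nu : 'M[R]_n :=
  if beta < n%:R + 2 then Ms_int mu lambda delta beta nu
  else Ms_hyp mu lambda delta beta nu.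

Definition peridynamic_multiplier mu lambda delta beta nu : 'M[R]_n :=
  Mb mu delta beta nu + Ms mu lambda delta beta nu.

Definition navier_multiplier mu lambda nu : 'M[R]_n :=
  - (lambda + mu) *: tensorv nu nu - (mu * enorm nu ^+ 2) *: 1%:M.

End multipliers.

(* Main.v *)
Require Import Defs.
From HB Require Import structures.
From mathcomp Require Import all_boot all_order all_algebra fingroup perm.
From mathcomp Require Import all_classical all_reals all_analysis.
From mathcomp Require Import measurable_realfun.
From mathcomp Require Import ring lra.
Set Implicit Arguments.
Unset Strict Implicit.
Unset Printing Implicit Defensive.
Import Order.TTheory GRing.Theory Num.Theory.
Import numFieldNormedType.Exports.
Local Open Scope classical_set_scope.
Local Open Scope ring_scope.

(* Replacing cos x - 1 by - x^2 / 2 and sin x by x turns the two integrals into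
   fourth moments T_ijkl of the radial weight |w|^(- beta - 2) over the ball,
   with an error at most a constant times J = int |w|^(4 - beta). By isotropy
   T_ijkl = I / (n (n + 2)) (d_ij d_kl + d_ik d_jl + d_il d_jk), where
   I = int |w|^(2 - beta), and the scaling constant is 2 n / I, so the main
   terms are exactly the Navier multipliers and the errors are O(J / I).
   Finally J <= delta^2 I, which settles delta -> 0; as beta -> n + 2, I tends
   to infinity while the contribution to J of |w| >= eps stays bounded, so
   J / I -> 0 again. At beta = n + 2 the hypergeometric series have a vanishing
   numerator parameter and reduce to their constant term 1. *)


(** * Taylor bounds for sine and cosine *)

(** Isotropy is extracted from three kinds of maps instead of the whole orthogonal group.
    Reflections kill every moment in which some coordinate occurs an odd number of times;
    permutations leave two unknowns, the moments of w_0^4 and of w_0^2 w_1^2; one rotation of a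
    coordinate plane ties these by the factor 3. The rotation is a product of shears because a shear
    is a translation on each line parallel to the first axis, so Fubini and translation invariance
    show that it preserves the measure. Integrals are total functions, hence every linear step has
    to be paid for by integrability. A single dominating function,
    [tnorm t ^+ 4 * weight beta (tnorm t)], serves throughout. It is studied at dyadic scales: cubes
    cover the shells from outside, disjoint boxes of comparable volume lie in the ball from inside,
    and both have product measures. The scale 2^-k contributes about 2^(-k (n + 2 - beta)), which is
    summable below the critical exponent and constant at it: this gives both the integrability and
    the blow-up of I. *)

Lemma ge0_of_derivative_ge0 {R : realType} (f df : R -> R) :
  (forall x : R, is_derive x 1 f (df x)) -> f 0 = 0 ->
  (forall x, 0 <= x -> 0 <= df x) -> forall x, 0 <= x -> 0 <= f x.
Proof.
move=> fdf f0 df_ge0 x; rewrite le_eqVlt => /predU1P[<-|x0]; first by rewrite f0.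
rewrite -f0.
have dfd y : derivable f y 1 by case: (fdf y).
apply: (@ger0_derive1_le_cc R f 0 x); rewrite ?in_itv/= ?lexx ?ltW//.
- move=> y; rewrite in_itv/= => /andP[y0 _].
  by rewrite derive1E (@derive_val _ _ _ _ _ _ _ (fdf y)) df_ge0// ltW.
- by apply: derivable_within_continuous => y _.
Qed.

(** Start of a chain fed by [cos x <= 1]: each of the next three remainders vanishes at 0 and has
    the preceding one as derivative, so its sign on the half-line is inherited. *)
Lemma sin_le_id {R : realType} (x : R) : 0 <= x -> 0 <= x - sin x.
Proof.
have d (y : R) : is_derive y 1 (fun x => x - sin x) (1 - cos y).
  exact: is_deriveB.
apply: (@ge0_of_derivative_ge0 _ _ _ d); first by rewrite sin0 subr0.
by move=> y _; rewrite subr_ge0 cos_le1.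
Qed.

Lemma cos_ge_taylor2 {R : realType} (x : R) :
  0 <= x -> 0 <= cos x - 1 + x ^+ 2 / 2.
Proof.
have d (y : R) : is_derive y 1 (fun x => cos x - 1 + x ^+ 2 / 2) (y - sin y).
  by apply: is_derive_eq; rewrite /GRing.scale/=; lra.
by apply: (@ge0_of_derivative_ge0 _ _ _ d _ sin_le_id); rewrite cos0; lra.
Qed.

Lemma sin_ge_taylor3 {R : realType} (x : R) :
  0 <= x -> 0 <= sin x - x + x ^+ 3 / 6.
Proof.
have d (y : R) : is_derive y 1 (fun x => sin x - x + x ^+ 3 / 6)
    (cos y - 1 + y ^+ 2 / 2).
  by apply: is_derive_eq; rewrite /GRing.scale/=; lra.
by apply: (@ge0_of_derivative_ge0 _ _ _ d _ cos_ge_taylor2); rewrite sin0; lra.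
Qed.

Lemma cos_le_taylor4 {R : realType} (x : R) :
  0 <= x -> 0 <= x ^+ 4 / 24 - (cos x - 1 + x ^+ 2 / 2).
Proof.
have d (y : R) : is_derive y 1 (fun x => x ^+ 4 / 24 - (cos x - 1 + x ^+ 2 / 2))
    (sin y - y + y ^+ 3 / 6).
  by apply: is_derive_eq; rewrite /GRing.scale/=; lra.
by apply: (@ge0_of_derivative_ge0 _ _ _ d _ sin_ge_taylor3); rewrite cos0; lra.
Qed.

(** Evenness reduces to [0 <= x], where the remainder lies between 0 and [x ^+ 4 / 24]. The constant
    is rounded up to 1, since only the order of the error matters. *)
Lemma cos_taylor_bound {R : realType} (x : R) :
  `|cos x - 1 + x ^+ 2 / 2| <= x ^+ 4.
Proof.
wlog x0 : x / 0 <= x.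
  move=> H; have [/H//|/ltW x0] := leP 0 x.
  by have := H (- x); rewrite oppr_ge0 cosN sqrrN;
    rewrite [(- x) ^+ 4]exprNn -signr_odd expr0 mul1r; apply.
have := cos_ge_taylor2 x0; have := cos_le_taylor4 x0 => h1 h2.
have : 0 <= x ^+ 4 by rewrite exprn_ge0.
by rewrite ger0_norm//; lra.
Qed.

Lemma sin_taylor_bound {R : realType} (x : R) : `|sin x - x| <= `|x| ^+ 3.
Proof.
wlog x0 : x / 0 <= x.
  move=> H; have [/H//|/ltW x0] := leP 0 x.
  by have := H (- x); rewrite oppr_ge0 sinN -opprD !normrN; apply.
have := sin_le_id x0; have := sin_ge_taylor3 x0 => h1 h2.
have : 0 <= x ^+ 3 by rewrite exprn_ge0.
by rewrite ler0_norm ?ger0_norm//; lra.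
Qed.


(** * Maps preserving Lebesgue measure *)

Section measure_preservation.
Context {R : realType}.
Local Notation T := (measurableTypeR R).
Local Notation lebesgue := (@lebesgue_measure R).

Lemma lebesgue_measure_preimage (f : R -> R) : measurable_fun [set: T] (f : T -> T) ->
  (forall a b, lebesgue (f @^-1` `]a, b]%classic) = lebesgue `]a, b]%classic) ->
  forall A : set T, measurable A -> lebesgue (f @^-1` A) = lebesgue A.
Proof.
move=> mf fE A mA.
pose m := measure_function_pushforward__canonical__measure_function_Measure
  lebesgue mf.
rewrite [RHS](@lebesgue_measure_unique _ m)// => _ [[a b] _ <-] /=.
by rewrite /pushforward fE.
Qed.

Lemma lebesgue_measure_translation (c : R) (A : set T) : measurable A ->
  lebesgue [set x | A (x + c)] = lebesgue A.
Proof.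
move: A; apply: (@lebesgue_measure_preimage (fun x : R => x + c)) => [|a b].
  exact: measurable_funD.
rewrite (_ : _ @^-1` _ = `]a - c, b - c]%classic).
  by rewrite !lebesgue_measure_itv/= !lte_fin ltrD2r -!EFinB opprB addrA subrK.
by apply/seteqP; split=> x; rewrite /= !in_itv/= ltrBlDr lerBrDr.
Qed.

Lemma lebesgue_measure_opp (A : set T) : measurable A ->
  lebesgue [set x | A (- x)] = lebesgue A.
Proof.
move: A; apply: (@lebesgue_measure_preimage -%R) => [|a b].
  exact: oppr_measurable.
rewrite (_ : _ @^-1` _ = `[- b, - a[%classic).
  by rewrite !lebesgue_measure_itv/= !lte_fin ltrN2 -!EFinB opprK addrC.
by apply/seteqP; split=> x; rewrite /= !in_itv/= lerNl ltrNr andbC.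
Qed.

Definition box n (A : 'I_n -> set T) : set (n.-tuple T) :=
  [set t | forall i, A i (tnth t i)].

Lemma measurable_box n (A : 'I_n -> set T) : (forall i, measurable (A i)) ->
  measurable (box A).
Proof.
move=> mA.
have -> : box A = \bigcap_(i in [set: 'I_n]) ((@tnth n T)^~ i @^-1` A i).
  by apply/seteqP; split=> t /= At i => [_|]; [exact: At|exact: (At i I)].
apply: fin_bigcap_measurable => // i _.
by rewrite -[X in measurable X]setTI; exact: measurable_tnth.
Qed.

Lemma lebesgue_box n (A : 'I_n -> set T) : (forall i, measurable (A i)) ->
  lebesgue_tuple n (box A) = (\prod_(i < n) lebesgue (A i))%E.
Proof. exact: lebesgue_tuple_box. Qed.

Lemma prodEFin n (f : 'I_n -> R) :
  (\prod_(i < n) (f i)%:E)%E = (\prod_(i < n) f i)%:E.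
Proof. by rewrite (big_morph EFin EFinM erefl). Qed.

(** Boxes are stable under intersection and generate the product sigma-algebra, and the cubes [g k]
    exhaust the space with finite measure, so two measures equal on boxes coincide. *)
Lemma lebesgue_tuple_unique n (m : {measure set (n.-tuple T) -> \bar R}) :
  (forall A : 'I_n -> set T, (forall i, measurable (A i)) ->
     m (box A) = (\prod_(i < n) lebesgue (A i))%E) ->
  forall A, measurable A -> lebesgue_tuple n A = m A.
Proof.
move=> mE.
pose G := [set X | exists A : 'I_n -> set T,
  (forall i, measurable (A i)) /\ X = box A].
pose g (k : nat) := box (fun _ : 'I_n => `]- k%:R, k%:R[%classic : set T).
apply: (measure_unique G g).
- apply/seteqP; split; last first.
    apply: smallest_sub; first exact: sigma_algebra_measurable.
    by move=> _ [A [mA ->]]; exact: measurable_box.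
  apply: sub_smallest2r => //.
  rewrite -bigcup_seq => X [i _] /= [B mB <-].
  (* A coordinate cylinder is a box whose other sides are full. *)
  exists (fun j => if j == i then B else setT); split.
    by move=> j; case: ifP.
  rewrite setTI; apply/seteqP; split=> t /=.
    by move=> Bt j; case: eqP => // ->.
  by move=> /(_ i); rewrite eqxx.
- move=> _ _ [A [mA ->]] [B [mB ->]].
  exists (fun i => A i `&` B i); split=> [i|]; first exact: measurableI.
  by apply/seteqP; split=> t /= => [[At Bt] i|AB]; do ?split; 
    by [exact: At|exact: Bt|move=> i; have [] := AB i].
- by move=> k; eexists; split; last reflexivity.
- apply/seteqP; split=> // t _.
  have [k kt] : exists k : nat, forall i, `|tnth t i| < k%:R.
    pose M := \sum_(i < n) `|tnth t i|.
    exists (Num.truncn M).+1 => i.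
    apply: (@le_lt_trans _ _ M); last exact: truncnS_gt.
    by rewrite /M (bigD1 i)//= lerDl sumr_ge0.
  by exists k => // i; rewrite /= in_itv/= -ltr_norml.
- by move=> _ [A [mA ->]]; rewrite mE//; exact: lebesgue_box.
- move=> k; suff : (lebesgue_tuple n (g k) < +oo)%E by [].
  rewrite /g lebesgue_box//.
  under eq_bigr do rewrite lebesgue_measure_itv/= lte_fin -EFinB -(fun_if EFin).
  by rewrite prodEFin ltry.
Qed.

Definition lebesgue_preserving n (S : n.-tuple T -> n.-tuple T) :=
  measurable_fun setT S /\
  forall A, measurable A -> lebesgue_tuple n (S @^-1` A) = lebesgue_tuple n A.

Lemma lebesgue_preserving_comp n (S1 S2 : n.-tuple T -> n.-tuple T) :
  lebesgue_preserving S1 -> lebesgue_preserving S2 ->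
  lebesgue_preserving (S1 \o S2).
Proof.
move=> [m1 p1] [m2 p2]; split; first exact: measurableT_comp.
move=> A mA; rewrite comp_preimage p2 ?p1//.
by rewrite -[X in measurable X]setTI; exact: m1.
Qed.

Lemma lebesgue_preserving_box n (S : n.-tuple T -> n.-tuple T) :
  measurable_fun setT S ->
  (forall A : 'I_n -> set T, (forall i, measurable (A i)) ->
     lebesgue_tuple n (S @^-1` box A) = (\prod_(i < n) lebesgue (A i))%E) ->
  lebesgue_preserving S.
Proof.
move=> mS SE; split=> // A mA.
pose m := measure_function_pushforward__canonical__measure_function_Measure
  (lebesgue_tuple n) mS.
by rewrite [RHS](@lebesgue_tuple_unique _ m).
Qed.

Definition permute_tuple n (s : {perm 'I_n}) (t : n.-tuple T) : n.-tuple T :=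
  [tuple tnth t (s i) | i < n].

Lemma permute_preserving n (s : {perm 'I_n}) : lebesgue_preserving (permute_tuple s).
Proof.
apply: lebesgue_preserving_box.
  apply/measurable_fun_tnthP => i.
  rewrite (_ : _ \o _ = fun t => tnth t (s i)); first exact: measurable_tnth.
  by apply/funext => t /=; rewrite tnth_mktuple.
move=> A mA.
rewrite (_ : _ @^-1` _ = box (fun i => A ((s^-1)%g i))).
  rewrite lebesgue_box// (reindex_inj (@perm_inj _ s))/=.
  by apply: eq_bigr => i _; rewrite permK.
apply/seteqP; split=> t /= At i.
  by have := At ((s^-1)%g i); rewrite tnth_mktuple permKV.
by rewrite tnth_mktuple; have := At (s i); rewrite permK.
Qed.

Definition flip_tuple n (j : 'I_n) (t : n.-tuple T) : n.-tuple T :=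
  [tuple if i == j then - tnth t i : R else tnth t i | i < n].

Lemma flip_preserving n (j : 'I_n) : lebesgue_preserving (flip_tuple j).
Proof.
apply: lebesgue_preserving_box.
  apply/measurable_fun_tnthP => i.
  rewrite (_ : _ \o _ = fun t => if i == j then - tnth t i : R else tnth t i).
    case: eqP => _; last exact: measurable_tnth.
    by apply: measurableT_comp; [exact: oppr_measurable|exact: measurable_tnth].
  by apply/funext => t /=; rewrite tnth_mktuple.
move=> A mA.
pose B i : set T := if i == j then [set x : R | A i (- x)] else A i.
have mB i : measurable (B i).
  rewrite /B; case: eqP => // _.
  by rewrite -[X in measurable X]setTI; exact: (oppr_measurable _ (mA i)).
rewrite (_ : _ @^-1` _ = box B).
  rewrite lebesgue_box//; apply: eq_bigr => i _; rewrite /B.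
  by case: eqP => // _; rewrite lebesgue_measure_opp.
by apply/seteqP; split=> t /= At i; have := At i; rewrite tnth_mktuple /B;
  case: eqP.
Qed.

(** Slicing with the tail fixed leaves a one-dimensional set in the head variable, the form in which
    a shear becomes a translation. *)
Lemma lebesgue_tuple_section n (A : set (n.+1.-tuple T)) : measurable A ->
  lebesgue_tuple n.+1 A =
  (\int[lebesgue_tuple n]_t lebesgue [set x | A (cons_pair (x, t))])%E.
Proof.
move=> mA.
have mcA : measurable (@cons_pair T n @^-1` A).
  by rewrite -[X in measurable X]setTI; exact: measurable_cons_pair.
rewrite [LHS](_ : _ = (lebesgue \x lebesgue_tuple n)%E (@cons_pair T n @^-1` A))//.
(* The product [\x] integrates over the head first; uniqueness of the product measure exchanges it
   for the iterated integral with the tail outside. *)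
rewrite (@product_measure_unique _ _ _ _ _ lebesgue (lebesgue_tuple n)
  (product_measure2 lebesgue (lebesgue_tuple n)))//; last first.
  by move=> B C mB mC; exact: product_measure2E.
apply: eq_integral => t _ /=; congr lebesgue.
by apply/seteqP; split=> x; rewrite /ysection/= inE.
Qed.

Definition shear_tuple n (a : R) (j : 'I_n) (t : n.+1.-tuple T) : n.+1.-tuple T :=
  cons_pair (thead t + a * tnth [tuple of behead t] j : R, [tuple of behead t]).

(** For a fixed tail [t] the shear translates the head by [a * tnth t j], so every slice keeps its
    length. *)
Lemma shear_preserving n (a : R) (j : 'I_n) : lebesgue_preserving (shear_tuple a j).
Proof.
have mS : measurable_fun setT (shear_tuple a j).
  apply: (measurableT_comp (@measurable_cons_pair R n)).
  apply/measurable_fun_pair; last exact: measurable_behead.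
  apply: measurable_funD; first exact: measurable_tnth.
  apply: measurable_funM => //.
  apply: (measurableT_comp (@measurable_tnth _ _ n j)); exact: measurable_behead.
split=> // A mA.
have mSA : measurable (shear_tuple a j @^-1` A).
  by rewrite -[X in measurable X]setTI; exact: mS.
rewrite !lebesgue_tuple_section//; apply: eq_integral => t _.
have mx : measurable_fun setT (fun x : T => cons_pair (x, t)).
  exact: (measurableT_comp (@measurable_cons_pair R n)
    (measurable_fun_pair (@measurable_id _ _ _) (measurable_cst t))).
rewrite -[RHS](@lebesgue_measure_translation (a * tnth t j)).
  congr lebesgue; apply/funext => x /=; congr A; rewrite /shear_tuple.
  by have [-> ->] : thead (cons_pair (x, t)) = x /\
    [tuple of behead (cons_pair (x, t))] = t by case: (cons_pairK (x, t)).
rewrite -[X in measurable X]setTI; exact: (mx measurableT _ mA).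
Qed.

End measure_preservation.


(** * Euclidean norm and balls on tuples, change of variables *)

Section euclidean_norm.
Context {R : realType}.
Local Notation T := (measurableTypeR R).

Definition tnorm n (t : n.-tuple T) : R := enorm (row_of_tuple t).

Lemma dotv_row n (t u : n.-tuple R) :
  dotv (row_of_tuple t) (row_of_tuple u) = \sum_(i < n) tnth t i * tnth u i.
Proof. by apply: eq_bigr => i _; rewrite !mxE. Qed.

Lemma tnorm_ge0 n (t : n.-tuple T) : 0 <= tnorm t.
Proof. exact: sqrtr_ge0. Qed.

Lemma sqr_tnorm n (t : n.-tuple T) :
  tnorm t ^+ 2 = \sum_(i < n) (tnth t i : R) ^+ 2.
Proof.
rewrite sqr_sqrtr dotv_row; first by apply: eq_bigr => i _; rewrite expr2.
by apply: sumr_ge0 => i _; rewrite -expr2 sqr_ge0.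
Qed.

Lemma eq_tnorm n (t u : n.-tuple T) :
  \sum_(i < n) (tnth t i : R) ^+ 2 = \sum_(i < n) (tnth u i : R) ^+ 2 ->
  tnorm t = tnorm u.
Proof.
by move=> tu; apply/eqP; rewrite -(eqrXn2 (n := 2)) ?tnorm_ge0// !sqr_tnorm tu.
Qed.

Lemma normr_tnth_le n (t : n.-tuple T) i : `|tnth t i : R| <= tnorm t.
Proof.
rewrite -(ler_pXn2r (n := 2)) ?nnegrE ?tnorm_ge0// sqr_tnorm real_normK ?num_real//.
by rewrite (bigD1 i)//= lerDl sumr_ge0// => j _; rewrite sqr_ge0.
Qed.

Lemma measurable_coord n (i : 'I_n) :
  measurable_fun setT (fun t : n.-tuple T => tnth t i : R).
Proof. exact: measurable_tnth. Qed.

Lemma measurable_sqrt : measurable_fun [set: R] (@Num.sqrt R).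
Proof. by apply: continuous_measurable_fun; exact: sqrt_continuous. Qed.

Lemma measurable_tnorm n : measurable_fun setT (@tnorm n).
Proof.
apply: (measurableT_comp measurable_sqrt).
under eq_fun do rewrite dotv_row.
by apply: measurable_sum => i; apply: measurable_funM; exact: measurable_coord.
Qed.

Lemma measurable_dot n (v : 'rV[R]_n) :
  measurable_fun setT (fun t : n.-tuple T => dotv v (row_of_tuple t)).
Proof.
rewrite /dotv; apply: measurable_sum => i; apply: measurable_funM => //.
by under eq_fun do rewrite mxE; exact: measurable_coord.
Qed.

Definition tball n (delta : R) : set (n.-tuple T) :=
  [set t | eball n delta (row_of_tuple t)].
Arguments tball : clear implicits.

Lemma measurable_tball n delta : measurable (tball n delta).
Proof.
rewrite -[X in measurable X]setTI.
rewrite [X in measurable X](_ : _ = setT `&` @tnorm n @^-1` `]-oo, delta[).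
  by apply: measurable_tnorm => //; exact: measurable_itv.
by apply/seteqP; split=> t /=; rewrite in_itv/=.
Qed.

(** The change of variables is proved for nonnegative functions and applied to the positive and
    negative parts of [f] separately. *)
Lemma Rintegral_preserving n (S : n.-tuple T -> n.-tuple T) (D : set (n.-tuple T))
    (f : n.-tuple T -> R) :
  lebesgue_preserving S -> measurable D -> measurable_fun setT f ->
  S @^-1` D = D ->
  \int[lebesgue_tuple n]_(t in D) f (S t) = \int[lebesgue_tuple n]_(t in D) f t.
Proof.
move=> [mS SE] mD mf SD.
have H (h : n.-tuple T -> \bar R) : measurable_fun setT h ->
    (forall t, 0 <= h t)%E ->
    (\int[lebesgue_tuple n]_(t in D) h (S t) =
     \int[lebesgue_tuple n]_(t in D) h t)%E.
  move=> mh h0; rewrite -{1}SD.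
  have -> : (fun t => h (S t)) = h \o S by [].
  rewrite -(ge0_integral_pushforward mS)//; last exact: measurable_funTS.
  by apply: eq_measure_integral => A mA _; exact: SE.
rewrite /Rintegral; congr fine; rewrite [LHS]integralE [RHS]integralE.
have mEf : measurable_fun setT (EFin \o f) by exact/measurable_EFinP.
rewrite (_ : (fun t => (f (S t))%:E) = (EFin \o f) \o S)//.
by rewrite funepos_comp funeneg_comp; congr (_ - _)%E; apply: H => //;
  [exact: measurable_funepos|exact: measurable_funeneg].
Qed.

End euclidean_norm.
Arguments tball {R} n delta _.


(** * Fourth moments of radial weights *)

Section radial_moments.
Context {R : realType} (n : nat) (delta : R) (g : R -> R).
Local Notation T := (measurableTypeR R).
Local Notation mu := (lebesgue_tuple n).
Local Notation D := (tball n delta).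
Hypothesis mg : measurable_fun [set: R] g.
Hypothesis g_ge0 : forall r, 0 <= g r.
Hypothesis intg :
  mu.-integrable D (EFin \o (fun t => tnorm t ^+ 4 * g (tnorm t))).

Definition moment (p : n.-tuple T -> R) : R :=
  \int[mu]_(t in D) (p t * g (tnorm t)).

(** The growth class for which [intg] alone gives integrability; it is a vector space containing all
    quartic monomials, which is what makes [moment] linear. *)
Definition quartic_bounded (p : n.-tuple T -> R) :=
  measurable_fun setT p /\ exists C, forall t, `|p t| <= C * tnorm t ^+ 4.

Lemma measurable_weight : measurable_fun setT (fun t : n.-tuple T => g (tnorm t)).
Proof. exact: (measurableT_comp mg (@measurable_tnorm R n)). Qed.

Lemma integrable_quartic (f : n.-tuple T -> R) (C : R) :
  measurable_fun setT f ->
  (forall t, D t -> `|f t| <= C * (tnorm t ^+ 4 * g (tnorm t))) ->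
  mu.-integrable D (EFin \o f).
Proof.
move=> mf fC; have mD := @measurable_tball R n delta.
apply: (le_integrable mD _ _ (integrableZl mD C intg)).
  by apply/measurable_EFinP; exact: measurable_funTS.
move=> t Dt; rewrite /= lee_fin (le_trans (fC t Dt))//.
exact: ler_norm.
Qed.

Lemma integrable_moment p : quartic_bounded p ->
  mu.-integrable D (EFin \o (fun t => p t * g (tnorm t))).
Proof.
move=> [mp [C pC]]; apply: (@integrable_quartic _ C).
  by apply: measurable_funM => //; exact: measurable_weight.
by move=> t _; rewrite normrM (ger0_norm (g_ge0 _)) mulrA ler_wpM2r.
Qed.

Lemma quartic_boundedD p q : quartic_bounded p -> quartic_bounded q ->
  quartic_bounded (fun t => p t + q t).
Proof.
move=> [mp [C pC]] [mq [C' qC']]; split; first exact: measurable_funD.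
exists (C + C') => t; rewrite mulrDl (le_trans (ler_normD _ _))//.
exact: lerD.
Qed.

Lemma quartic_boundedZ c p : quartic_bounded p -> quartic_bounded (fun t => c * p t).
Proof.
move=> [mp [C pC]]; split; first exact: measurable_funM.
exists (`|c| * C) => t; rewrite normrM -mulrA ler_wpM2l//.
Qed.

Lemma quartic_bounded0 : quartic_bounded (fun=> 0).
Proof. by split; [exact: measurable_cst|exists 0 => t; rewrite normr0 mul0r]. Qed.

Lemma quartic_bounded_sum (I : Type) (r : seq I) (p : I -> n.-tuple T -> R) :
  (forall i, quartic_bounded (p i)) ->
  quartic_bounded (fun t => \sum_(i <- r) p i t).
Proof.
move=> qp; elim: r => [|i r IHr].
  by under eq_fun do rewrite big_nil; exact: quartic_bounded0.
by under eq_fun do rewrite big_cons; exact: quartic_boundedD.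
Qed.

Lemma momentD p q : quartic_bounded p -> quartic_bounded q ->
  moment (fun t => p t + q t) = moment p + moment q.
Proof.
move=> qp qq; rewrite /moment -RintegralD; first last.
- exact: integrable_moment.
- exact: integrable_moment.
- exact: measurable_tball.
by apply: eq_Rintegral => t _; rewrite mulrDl.
Qed.

Lemma momentZ c p : quartic_bounded p -> moment (fun t => c * p t) = c * moment p.
Proof.
move=> qp; rewrite /moment -RintegralZl; first last.
- exact: integrable_moment.
- exact: measurable_tball.
by apply: eq_Rintegral => t _; rewrite mulrA.
Qed.

Lemma moment0 : moment (fun=> 0) = 0.
Proof.
rewrite /moment; under eq_Rintegral do rewrite mul0r.
by rewrite Rintegral_cst ?mul0r//; exact: measurable_tball.
Qed.

Lemma moment_sum (I : Type) (r : seq I) (p : I -> n.-tuple T -> R) :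
  (forall i, quartic_bounded (p i)) ->
  moment (fun t => \sum_(i <- r) p i t) = \sum_(i <- r) moment (p i).
Proof.
move=> qp; elim: r => [|i r IHr].
  by rewrite big_nil; under [in LHS]eq_fun do rewrite big_nil; exact: moment0.
under [in LHS]eq_fun do rewrite big_cons.
by rewrite big_cons momentD ?IHr//; exact: quartic_bounded_sum.
Qed.

Lemma moment_preserving S p : lebesgue_preserving S ->
  (forall t, tnorm (S t) = tnorm t) -> measurable_fun setT p ->
  moment (fun t => p (S t)) = moment p.
Proof.
move=> pS nS mp; rewrite /moment.
under eq_Rintegral do rewrite -nS.
rewrite (Rintegral_preserving (f := fun t => p t * g (tnorm t)))//.
- exact: measurable_tball.
- by apply: measurable_funM => //; exact: measurable_weight.
- apply/seteqP; split=> t; rewrite /tball/= /eball/=.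
    by move: (nS t); rewrite /tnorm => ->.
  by move: (nS t); rewrite /tnorm => ->.
Qed.

Definition quad (i j k l : 'I_n) (t : n.-tuple T) : R :=
  tnth t i * tnth t j * tnth t k * tnth t l.

Lemma measurable_quad i j k l : measurable_fun setT (quad i j k l).
Proof.
by do 3 (apply: measurable_funM; last exact: measurable_coord);
  exact: measurable_coord.
Qed.

Lemma quartic_bounded_quad i j k l : quartic_bounded (quad i j k l).
Proof.
split; first exact: measurable_quad.
exists 1 => t; rewrite mul1r /quad !normrM 3!exprSr expr1.
by do 3 (apply: ler_pM; rewrite ?mulr_ge0// ?normr_tnth_le//).
Qed.

Lemma tnorm_permute (s : {perm 'I_n}) (t : n.-tuple T) :
  tnorm (permute_tuple s t) = tnorm t.
Proof.
apply: eq_tnorm; rewrite [RHS](reindex_inj (@perm_inj _ s))/=.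
by apply: eq_bigr => i _; rewrite tnth_mktuple.
Qed.

Lemma tnorm_flip (j : 'I_n) (t : n.-tuple T) : tnorm (flip_tuple j t) = tnorm t.
Proof.
apply: eq_tnorm; apply: eq_bigr => i _.
by rewrite tnth_mktuple; case: eqP => // _; rewrite sqrrN.
Qed.

Lemma moment_quad_permute (s : {perm 'I_n}) i j k l :
  moment (quad (s i) (s j) (s k) (s l)) = moment (quad i j k l).
Proof.
rewrite -[RHS](moment_preserving (permute_preserving s) (tnorm_permute s));
  last exact: measurable_quad.
by congr moment; apply/funext => t; rewrite /quad !tnth_mktuple.
Qed.

(** Changing the sign of coordinate [a] multiplies the monomial by -1 to the power of the
    multiplicity of [a]; for an odd multiplicity the moment equals its own opposite. *)
Lemma moment_quad_odd a i j k l : odd ((i == a) + (j == a) + (k == a) + (l == a)) ->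
  moment (quad i j k l) = 0.
Proof.
move=> o; suff: moment (quad i j k l) = - moment (quad i j k l) by lra.
rewrite -[LHS](moment_preserving (flip_preserving a) (tnorm_flip a));
  last exact: measurable_quad.
rewrite -[RHS]mulN1r -momentZ; last exact: quartic_bounded_quad.
congr moment; apply/funext => t; rewrite /quad !tnth_mktuple.
by move: o; do 4 case: (_ == a) => //=; move=> _; ring.
Qed.

End radial_moments.


(** * Isotropy of the fourth moments and their contractions *)

Section isotropy.
Context {R : realType} (n : nat) (delta : R) (g : R -> R).
Local Notation T := (measurableTypeR R).
Local Notation mu := (lebesgue_tuple n.+1).
Local Notation D := (tball n.+1 delta).
Hypothesis mg : measurable_fun [set: R] g.
Hypothesis g_ge0 : forall r, 0 <= g r.
Hypothesis intg :
  mu.-integrable D (EFin \o (fun t => tnorm t ^+ 4 * g (tnorm t))).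
Local Notation moment := (@moment R n.+1 delta g).
Local Notation qquad := (@quartic_bounded_quad R n.+1).

Lemma tnth_behead_lift (t : n.+1.-tuple T) (k : 'I_n) :
  tnth [tuple of behead t] k = tnth t (lift ord0 k).
Proof.
by rewrite tnth_behead; congr tnth; apply/val_inj; rewrite /= inordK// ltnS.
Qed.

Lemma tnth_shear (a : R) (j : 'I_n) (t : n.+1.-tuple T) i :
  tnth (shear_tuple a j t) i =
  if i == ord0 then tnth t ord0 + a * tnth t (lift ord0 j) : R else tnth t i.
Proof.
rewrite /shear_tuple tnth_behead_lift.
by case: (unliftP ord0 i) => [k ->|->] /=; rewrite ?tnthS ?tnth_behead_lift.
Qed.

(* The rotation of angle [theta], with [cos theta = 3/5] and [sin theta = 4/5],
   is the product of three shears, with parameters [- tan (theta / 2) = - 1/2],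
   [sin theta] and [- tan (theta / 2)]. *)
Definition rotation (j : 'I_n) : n.+1.-tuple T -> n.+1.-tuple T :=
  let s := permute_tuple (tperm ord0 (lift ord0 j)) in
  shear_tuple (- 2^-1) j \o (s \o (shear_tuple (4 / 5) j \o
    (s \o shear_tuple (- 2^-1) j))).

(** [shear_tuple] alters only the head; the middle shear, which must alter the other coordinate of
    the plane, is obtained by conjugation with a transposition. *)
Lemma rotation_preserving j : lebesgue_preserving (rotation j).
Proof.
do ![apply: lebesgue_preserving_comp]; do ?[exact: shear_preserving];
  exact: permute_preserving.
Qed.

Lemma tnth_rotation j t i : tnth (rotation j t) i =
  if i == ord0 then 3 / 5 * tnth t ord0 - 4 / 5 * tnth t (lift ord0 j) : R
  else if i == lift ord0 j then
    4 / 5 * tnth t ord0 + 3 / 5 * tnth t (lift ord0 j) : R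
  else tnth t i.
Proof.
have kP : lift ord0 j == ord0 = false by [].
rewrite /rotation /=; set k := lift ord0 j.
have [->|i0] := eqVneq i ord0.
  rewrite !(tnth_shear, tnth_mktuple, tpermL, tpermR) -/k !kP !eqxx /=.
  by field.
rewrite !(tnth_shear, tnth_mktuple, tpermL, tpermR) (negPf i0) tpermK (negPf i0).
have [->|ik] := eqVneq i k; first by rewrite tpermR eqxx /= -/k; field.
by rewrite tpermD 1?eq_sym // ?(negPf i0) // eq_sym (negPf i0).
Qed.

Lemma tnorm_rotation j t : tnorm (rotation j t) = tnorm t.
Proof.
apply: eq_tnorm.
have E (F : 'I_n.+1 -> R) : \sum_i F i = F ord0 + F (lift ord0 j) +
    \sum_(i | (i != ord0) && (i != lift ord0 j)) F i.
  by rewrite (bigD1 ord0)//= (bigD1 (lift ord0 j))//= addrA.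
rewrite [LHS]E [RHS]E; congr (_ + _); first by rewrite !tnth_rotation !eqxx/=; field.
by apply: eq_bigr => i /andP[i0 ij]; rewrite tnth_rotation (negPf i0) (negPf ij).
Qed.

(** This is the relation that signed permutations cannot provide: the moment of the fourth power of
    a coordinate is the same after the rotation. *)
Lemma moment_quad_rotation (j : 'I_n) : let k := lift ord0 j in
  moment (quad ord0 ord0 ord0 ord0) = 3 * moment (quad ord0 ord0 k k).
Proof.
move=> k; have kP : k == ord0 = false by [].
have odd1 : moment (quad ord0 ord0 ord0 k) = 0.
  by apply: (moment_quad_odd mg g_ge0 intg (a := k)); rewrite eqxx eq_sym kP.
have odd3 : moment (quad ord0 k k k) = 0.
  by apply: (moment_quad_odd mg g_ge0 intg (a := k)); rewrite eqxx eq_sym kP.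
have kk : moment (quad k k k k) = moment (quad ord0 ord0 ord0 ord0).
  by rewrite -(moment_quad_permute delta mg (tperm ord0 k) ord0) tpermL.
(* Binomial expansion of (3/5 x - 4/5 y)^4. The terms odd in x and y vanish, and 625 - 81 - 256 =
   288 is a third of 864. *)
have : moment (quad ord0 ord0 ord0 ord0) =
    81 / 625 * moment (quad ord0 ord0 ord0 ord0) +
    (- 432 / 625 * moment (quad ord0 ord0 ord0 k) +
    (864 / 625 * moment (quad ord0 ord0 k k) +
    (- 768 / 625 * moment (quad ord0 k k k) +
    256 / 625 * moment (quad k k k k)))).
  rewrite -[LHS](moment_preserving delta mg (rotation_preserving j) (tnorm_rotation j));
    last exact: measurable_quad.
  rewrite -!(momentZ mg g_ge0 intg); do ?[exact: quartic_bounded_quad].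
  rewrite -!(momentD mg g_ge0 intg);
    do ?[exact: quartic_bounded_quad|apply: quartic_boundedD|apply: quartic_boundedZ].
  by congr moment; apply/funext => t; rewrite /quad !tnth_rotation /=; field.
by rewrite odd1 odd3 kk; lra.
Qed.

Lemma moment_quad_iijj (i j : 'I_n.+1) : i != j ->
  moment (quad i i j j) = moment (quad ord0 ord0 ord0 ord0) / 3.
Proof.
move=> ij; rewrite -(moment_quad_permute delta mg (tperm ord0 i)) tpermR.
case: (unliftP ord0 (tperm ord0 i j)) => [k ->|E].
  by rewrite (moment_quad_rotation k); field.
by move: ij; rewrite -[j](tpermK ord0 i) E tpermL eqxx.
Qed.

Lemma moment_quad_iiii i :
  moment (quad i i i i) = moment (quad ord0 ord0 ord0 ord0).
Proof. by rewrite -(moment_quad_permute delta mg (tperm ord0 i) ord0) tpermL. Qed.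

(** If the four indices do not match in pairs, one of them has odd multiplicity and both sides
    vanish. If they match in exactly one way the bracket is 1; if all are equal it is 3, which the
    division by 3 compensates. *)
Lemma moment_quadE i j k l : moment (quad i j k l) =
  moment (quad ord0 ord0 ord0 ord0) / 3 *
  ((i == j)%:R * (k == l)%:R + (i == k)%:R * (j == l)%:R
   + (i == l)%:R * (j == k)%:R).
Proof.
have quadC (a b c d : 'I_n.+1) : quad (R := R) a b c d = quad a c b d.
  by apply/funext => t; rewrite /quad; ring.
have quadC' (a b c d : 'I_n.+1) : quad (R := R) a b c d = quad a d c b.
  by apply/funext => t; rewrite /quad; ring.
have odd0 a : odd ((i == a) + (j == a) + (k == a) + (l == a)) ->
   moment (quad i j k l) = 0 by exact: moment_quad_odd.
have [ij|ij] := eqVneq i j.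
  subst j; have [kl|kl] := eqVneq k l.
    subst l; have [ik|ik] := eqVneq i k.
      by subst k; rewrite moment_quad_iiii /=; field.
    by rewrite moment_quad_iijj//=; field.
  have [ik|ik] := eqVneq i k.
    by subst k; rewrite (odd0 l) ?eqxx ?(negPf kl)//=; ring.
  by rewrite (odd0 k) ?eqxx ?(negPf ik) ?[l == k]eq_sym ?(negPf kl)//=; ring.
have ji : (j == i) = false by rewrite eq_sym (negPf ij).
have [ik|ik] := eqVneq i k.
  subst k; have [jl|jl] := eqVneq j l.
    subst l; rewrite (negPf ij) quadC moment_quad_iijj//= ji.
    by ring.
  by rewrite (odd0 j) ?eqxx ?(negPf ij) ?[l == j]eq_sym ?(negPf jl)// ji /=; ring.
have [il|il] := eqVneq i l.
  subst l; have [jk|jk] := eqVneq j k.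
    subst k; rewrite quadC' moment_quad_iijj//=.
    by ring.
  by rewrite (odd0 j) ?eqxx ?(negPf ij) ?[k == j]eq_sym ?(negPf jk)//=; ring.
by rewrite (odd0 i) ?eqxx ?ji ?[k == i]eq_sym ?[l == i]eq_sym
  ?(negPf ik) ?(negPf il)//=; ring.
Qed.

(** Double trace of the tensor: the sum over i and k of 1 + 2 d_ik. It determines the one remaining
    unknown from the radial integral. *)
Lemma moment_tnorm4 : moment (fun t => tnorm t ^+ 4) =
  moment (quad ord0 ord0 ord0 ord0) / 3 * (n.+1%:R * (n.+1%:R + 2)).
Proof.
have -> : (fun t : n.+1.-tuple T => tnorm t ^+ 4) =
    fun t => \sum_i \sum_k quad i i k k t.
  apply/funext => t; rewrite (exprM _ 2 2) sqr_tnorm expr2 mulr_suml.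
  apply: eq_bigr => i _; rewrite mulr_sumr; apply: eq_bigr => k _.
  by rewrite /quad; ring.
rewrite (moment_sum mg g_ge0 intg); last first.
  by move=> i; apply: quartic_bounded_sum => k; exact: qquad.
have E i : moment (fun t => \sum_k quad i i k k t) =
    moment (quad ord0 ord0 ord0 ord0) / 3 * (n.+1%:R + 2).
  rewrite (moment_sum mg g_ge0 intg); last by move=> k; exact: qquad.
  under eq_bigr do
    rewrite moment_quadE !eqxx !mul1r -natrM mulnb andbb -addrA -mulr2n.
  rewrite -mulr_sumr big_split/=; congr (_ * (_ + _)).
    by rewrite sumr_const card_ord.
  by rewrite (bigD1 i)//= eqxx big1 ?addr0// => k ki; rewrite eq_sym (negPf ki) mul0rn.
by under eq_bigr do rewrite E; rewrite sumr_const card_ord -mulr_natr; ring.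
Qed.

Lemma sum_delta (F : 'I_n.+1 -> R) k : \sum_l F l * (k == l)%:R = F k.
Proof.
rewrite (bigD1 k)//= eqxx mulr1 big1 ?addr0// => l lk.
by rewrite eq_sym (negPf lk) mulr0.
Qed.

Lemma moment_quad0 : moment (quad ord0 ord0 ord0 ord0) / 3 =
  moment (fun t => tnorm t ^+ 4) / (n.+1%:R * (n.+1%:R + 2)).
Proof.
by rewrite moment_tnorm4 mulfK// mulf_neq0// -?natrD pnatr_eq0.
Qed.

Lemma moment_dot2 (nu : 'rV[R]_n.+1) i j :
  moment (fun t => tnth t i * tnth t j * dotv nu (row_of_tuple t) ^+ 2) =
  moment (fun t => tnorm t ^+ 4) / (n.+1%:R * (n.+1%:R + 2)) *
  ((i == j)%:R * dotv nu nu + 2 * (nu 0 i * nu 0 j)).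
Proof.
have -> : (fun t : n.+1.-tuple T =>
      tnth t i * tnth t j * dotv nu (row_of_tuple t) ^+ 2) =
    fun t => \sum_k \sum_l nu 0 k * nu 0 l * quad i j k l t.
  apply/funext => t; rewrite expr2 {1}/dotv mulr_suml mulr_sumr.
  apply: eq_bigr => k _; rewrite /dotv !mulr_sumr; apply: eq_bigr => l _.
  by rewrite /quad !mxE; ring.
rewrite (moment_sum mg g_ge0 intg); last first.
  move=> k; apply: quartic_bounded_sum => l; apply: quartic_boundedZ; exact: qquad.
rewrite -moment_quad0.
have E k : moment (fun t => \sum_l nu 0 k * nu 0 l * quad i j k l t) =
    moment (quad ord0 ord0 ord0 ord0) / 3 *
    ((i == j)%:R * (nu 0 k * nu 0 k) + nu 0 k * nu 0 j * (i == k)%:R +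
      nu 0 k * nu 0 i * (j == k)%:R).
  rewrite (moment_sum mg g_ge0 intg); last first.
    by move=> l; apply: quartic_boundedZ; exact: qquad.
  under eq_bigr do rewrite (momentZ mg g_ge0 intg _ (qquad _ _ _ _)) moment_quadE.
  rewrite -[nu 0 k * nu 0 k](sum_delta (fun l => nu 0 k * nu 0 l) k).
  rewrite -[nu 0 k * nu 0 j](sum_delta (fun l => nu 0 k * nu 0 l) j).
  rewrite -[nu 0 k * nu 0 i](sum_delta (fun l => nu 0 k * nu 0 l) i).
  rewrite [in RHS]mulr_sumr !mulr_suml -!big_split/= mulr_sumr.
  by apply: eq_bigr => l _; ring.
under eq_bigr do rewrite E.
rewrite -mulr_sumr !big_split/= -mulr_sumr.
rewrite (sum_delta (fun k => nu 0 k * nu 0 j)) (sum_delta (fun k => nu 0 k * nu 0 i)).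
by rewrite /dotv; ring.
Qed.

(** The sine integrand has exponent [beta] where the cosine one has [beta + 2]; the factor
    [tnorm t ^+ 2] makes up the difference, so this is a partial trace of the same tensor. The trace
    contributes N + 2, which cancels that factor of the denominator. *)
Lemma moment_dot1 (nu : 'rV[R]_n.+1) i :
  moment (fun t => tnth t i * dotv nu (row_of_tuple t) * tnorm t ^+ 2) =
  moment (fun t => tnorm t ^+ 4) / n.+1%:R * nu 0 i.
Proof.
have -> : (fun t : n.+1.-tuple T =>
      tnth t i * dotv nu (row_of_tuple t) * tnorm t ^+ 2) =
    fun t => \sum_k nu 0 k * \sum_l quad i k l l t.
  apply/funext => t; rewrite sqr_tnorm /dotv -mulrA mulr_suml mulr_sumr.
  apply: eq_bigr => k _; rewrite !mulr_sumr; apply: eq_bigr => l _.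
  by rewrite /quad !mxE; ring.
have qs k : quartic_bounded (fun t : n.+1.-tuple T => \sum_l quad i k l l t).
  by apply: quartic_bounded_sum => l; exact: qquad.
rewrite (moment_sum mg g_ge0 intg); last by move=> k; exact: quartic_boundedZ.
have E k : moment (fun t => nu 0 k * \sum_l quad i k l l t) =
    moment (quad ord0 ord0 ord0 ord0) / 3 * (n.+1%:R + 2) * (nu 0 k * (i == k)%:R).
  rewrite (momentZ mg g_ge0 intg)// (moment_sum mg g_ge0 intg); last first.
    by move=> l; exact: qquad.
  under eq_bigr do rewrite moment_quadE eqxx mulr1 -addrA -mulr2n -[_ *+ 2]mulr_natr.
  rewrite -mulr_sumr big_split/= sumr_const card_ord -mulr_suml.
  rewrite (sum_delta (fun l => (i == l)%:R)) eq_sym.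
  by rewrite -[_ *+ n.+1]mulr_natr; ring.
under eq_bigr do rewrite E.
have N0 : n.+1%:R != 0 :> R by rewrite pnatr_eq0.
have N2 : n.+1%:R + 2 != 0 :> R by rewrite -natrD pnatr_eq0.
rewrite -mulr_sumr sum_delta moment_quad0; move: N0 N2.
by move: (n.+1%:R : R) => N N0 N2; field; rewrite N0.
Qed.

End isotropy.


(** * Power weights and the dyadic decomposition *)

Section power_weight.
Context {R : realType}.
Local Notation T := (measurableTypeR R).

(** The exponent is that of the cosine integrand. The conventional value at [r = 0] is harmless
    because the weight always occurs multiplied by a function vanishing there. *)
Definition weight (beta r : R) : R := (r `^ (beta + 2))^-1.

Lemma weight_ge0 beta r : 0 <= weight beta r.
Proof. by rewrite invr_ge0 powR_ge0. Qed.

Lemma measurable_weight_fun beta : measurable_fun [set: R] (weight beta).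
Proof.
rewrite (_ : weight beta = fun r => r `^ (- (beta + 2))).
  exact: measurable_powR.
by apply/funext => r; rewrite powRN.
Qed.

Lemma weight4 beta r : 0 < r -> r ^+ 4 * weight beta r = r `^ (2 - beta).
Proof.
move=> r0; rewrite /weight -powR_mulrn ?ltW// -powRB; last first.
  by rewrite (gt_eqF r0) implybT.
by congr (_ `^ _); ring.
Qed.

(** On a shell the power is largest at the outer radius for [0 <= p] and at the inner one for
    [p < 0]; adding the two bounds spares later case distinctions on the sign. *)
Lemma powR_le_shell (p c r : R) : 0 < c -> c / 2 <= r <= c ->
  r `^ p <= (1 + 2^-1 `^ p) * c `^ p.
Proof.
move=> c0 /andP[cr rc]; have c20 : 0 < c / 2 by rewrite divr_gt0.
have r0 : 0 < r by exact: lt_le_trans cr.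
rewrite mulrDl mul1r; have [p0|p0] := leP 0 p.
  rewrite (@le_trans _ _ (c `^ p))//; last by rewrite lerDl mulr_ge0// powR_ge0.
  by rewrite ge0_ler_powR// nnegrE ltW.
rewrite -powRM ?invr_ge0 ?ler0n ?(ltW c0)// [2^-1 * c]mulrC.
apply: ler_wpDl; first exact: powR_ge0.
rewrite -[p]opprK !(powRN _ (- p)) lef_pV2 ?posrE ?powR_gt0//.
by rewrite ge0_ler_powR// ?nnegrE ?ltW// oppr_gt0.
Qed.

Lemma powR_halves (s c : R) k : 0 <= c ->
  (c / 2 ^+ k) `^ s = c `^ s * (2^-1 `^ s) ^+ k.
Proof.
move=> c0; rewrite powRM// ?invr_ge0 ?exprn_ge0// -exprVn.
by rewrite -powR_mulrn ?powR_ge0// powRAC powR_mulrn// invr_ge0.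
Qed.

Definition cube n (c : R) : set (n.-tuple T) :=
  box (fun _ => `]- c, c[%classic : set T).

Lemma measurable_cube n c : measurable (@cube n c).
Proof. by apply: measurable_box => i; exact: measurable_itv. Qed.

Lemma lebesgue_cube n c : 0 < c -> lebesgue_tuple n (@cube n c) = ((2 * c) ^+ n)%:E.
Proof.
move=> c0; rewrite lebesgue_box; last by move=> i; exact: measurable_itv.
under eq_bigr do
  rewrite lebesgue_measure_itv/= lte_fin gtrN// -EFinB opprK -mulr2n -mulr_natl.
by rewrite prodEFin prodr_const card_ord.
Qed.

Lemma tball_cube n c (t : n.-tuple T) : tnorm t < c -> cube c t.
Proof.
by move=> tc i /=; rewrite in_itv/= -ltr_norml (le_lt_trans _ tc)// normr_tnth_le.
Qed.

Lemma dyadic_shell (delta r : R) : 0 < r -> r < delta ->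
  exists k, delta / 2 ^+ k / 2 <= r < delta / 2 ^+ k.
Proof.
move=> r0 rd; have d0 := lt_trans r0 rd.
have ex : exists k, delta / 2 ^+ k / 2 <= r.
  pose m := (Num.truncn (delta / r)).+1; exists m.
  have dm : delta / r < m%:R by exact: truncnS_gt.
  have m2 : (m%:R : R) <= 2 ^+ m by rewrite -natrX ler_nat ltnW// ltn_expl.
  have dr : delta / 2 ^+ m <= r.
    rewrite ler_pdivrMr ?exprn_gt0// mulrC -ler_pdivrMr//.
    exact: le_trans (ltW dm) m2.
  have : 0 <= delta / 2 ^+ m by rewrite divr_ge0 ?exprn_ge0// ltW.
  by move: dr; move: (delta / _) => u; lra.
exists (ex_minn ex); case: ex_minnP => -[|k] kr kmin; rewrite kr /=.
  by rewrite expr0 divr1.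
rewrite ltNge; apply/negP => h.
suff /kmin : delta / 2 ^+ k / 2 <= r by rewrite ltnn.
by rewrite -mulrA -invfM -exprSr.
Qed.

(** On each dyadic shell the integrand is at most a constant times the power of the outer radius;
    replacing the shell by the cube containing it gives a geometric series of integrals. *)
Lemma integrable_weight n (delta beta : R) : beta < n%:R + 2 -> 0 < delta ->
  (lebesgue_tuple n).-integrable (tball n delta)
    (EFin \o (fun t => tnorm t ^+ 4 * weight beta (tnorm t))).
Proof.
move=> bn d0; have mD := @measurable_tball R n delta.
pose f (t : n.-tuple T) := tnorm t ^+ 4 * weight beta (tnorm t).
have mf : measurable_fun setT f.
  apply: measurable_funM; last first.
    exact: (measurableT_comp (measurable_weight_fun beta) (@measurable_tnorm R n)).
  by apply: measurable_funX; exact: measurable_tnorm.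
have f0 t : 0 <= f t by exact: mulr_ge0 (exprn_ge0 _ (tnorm_ge0 _)) (weight_ge0 _ _).
apply/integrableP; split; first by apply/measurable_EFinP; exact: measurable_funTS.
pose p := 2 - beta; pose M := 1 + 2^-1 `^ p : R.
have M0 : 0 <= M by rewrite addr_ge0// powR_ge0.
pose c k := delta / 2 ^+ k.
have c0 k : 0 < c k by rewrite divr_gt0// exprn_gt0.
pose a k := M * c k `^ p.
have a0 k : 0 <= a k by rewrite mulr_ge0// powR_ge0.
pose h k (t : n.-tuple T) : \bar R := ((a k)%:E * (\1_(cube (c k)) t)%:E)%E.
have h0 k t : (0 <= h k t)%E by rewrite mule_ge0// lee_fin.
have mh k : measurable_fun setT (h k).
  apply: emeasurable_funM => //; apply/measurable_EFinP.
  by apply: measurable_indic; exact: measurable_cube.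
have fh t : tball n delta t -> ((f t)%:E <= \sum_(k <oo) h k t)%E.
  move=> Dt; have := tnorm_ge0 t; rewrite le_eqVlt => /predU1P[t0|t0].
    (* The origin lies in no shell, but there the factor [tnorm t ^+ 4] vanishes. *)
    by rewrite /f -t0 expr0n/= mul0r nneseries_ge0.
  have [k /andP[kt tk]] := dyadic_shell t0 Dt.
  apply: (@le_trans _ _ (h k t)); last first.
    apply: le_trans (nneseries_lim_ge k.+1 _) => //.
    by rewrite big_nat_recr//= leeDr// sume_ge0.
  rewrite /h indicE mem_set ?mule1; last exact: tball_cube.
  by rewrite lee_fin /f weight4// powR_le_shell// kt ltW.
(* The exponent is n + 2 - beta: convergence of the series is exactly subcriticality. *)
have q1 : 2^-1 `^ (n%:R + p) < 1 :> R.
  rewrite [ltRHS](_ : _ = 1 `^ (n%:R + p)); last by rewrite powR1.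
  rewrite gt0_ltr_powR ?nnegrE//; first by rewrite /p; lra.
  by rewrite invf_lt1// ltr1n.
set q : R := 2^-1 `^ (n%:R + p) in q1.
have q0 : 0 <= q by exact: powR_ge0.
(* The cube of half-side [c k] has measure (2 c_k)^n; multiplied by M c_k^p this is [A * q ^+ k]. *)
pose A := M * 2 ^+ n * delta `^ (n%:R + p).
have hint k : (\int[lebesgue_tuple n]_(t in tball n delta) h k t <= (A * q ^+ k)%:E)%E.
  rewrite ge0_integralZl_EFin//; last first.
    apply/measurable_EFinP; apply: measurable_funTS.
    by apply: measurable_indic; exact: measurable_cube.
  rewrite integral_indic//; last exact: measurable_cube.
  apply: (@le_trans _ _ ((a k)%:E * ((2 * c k) ^+ n)%:E)%E).
    rewrite lee_wpmul2l ?lee_fin// -lebesgue_cube// le_measure ?inE//.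
    - by apply: measurableI => //; exact: measurable_cube.
    - exact: measurable_cube.
  rewrite -EFinM lee_fin /a /A -!mulrA ler_wpM2l// exprMn mulrCA ler_wpM2l ?exprn_ge0//.
  rewrite -powR_halves ?(ltW d0)// -/(c k) -powR_mulrn ?(ltW (c0 k))// -powRD; last first.
    by rewrite (gt_eqF (c0 k)) implybT.
  by rewrite addrC.
apply: (@le_lt_trans _ _
    (\int[lebesgue_tuple n]_(t in tball n delta) \sum_(k <oo) h k t)%E).
  apply: ge0_le_integral => //.
  - by apply: measurableT_comp => //; apply/measurable_EFinP; exact: measurable_funTS.
  - by apply: ge0_emeasurable_sum => [k t _ _|k _]; [exact: h0|exact: measurable_funTS].
  - by move=> t Dt; rewrite /= ger0_norm ?f0//; exact: fh.
rewrite integral_nneseries//; last by move=> k; exact: measurable_funTS.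
apply: (@le_lt_trans _ _ (A / (1 - q))%:E); last exact: ltry.
apply: lime_le.
  by apply: is_cvg_nneseries => k _ _; exact: integral_ge0.
apply: nearW => k; apply: (@le_trans _ _ (\sum_(0 <= i < k) (A * q ^+ i)%:E)%E).
  exact: lee_sum.
rewrite sumEFin lee_fin -mulr_sumr ler_wpM2l//.
  exact: mulr_ge0 (mulr_ge0 M0 (exprn_ge0 _ (ler0n _ _))) (powR_ge0 _ _).
have := geometric_seriesE 1 (negbT (lt_eqF q1)) => /(congr1 (fun u => u k)).
rewrite /series/=; under eq_bigr do rewrite mul1r; move=> ->.
by rewrite mul1r ler_pdivrMr ?subr_gt0// mulVf ?gt_eqF ?subr_gt0// gerBl exprn_ge0.
Qed.

End power_weight.


(** * Upper and lower bounds for the radial integrals I and J *)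

Section even_moments.
Context {R : realType} (n : nat).
Local Notation T := (measurableTypeR R).
Local Notation N := (n.+1%:R : R).
Local Notation mu := (lebesgue_tuple n.+1).

(** [moment4] is I and [moment6] is J: the powers 4 and 6 are 2 - beta and 4 - beta once the
    exponent [beta + 2] of the weight is absorbed. *)
Definition moment4 (delta beta : R) :=
  moment delta (weight beta) (fun t : n.+1.-tuple T => tnorm t ^+ 4).

Definition moment6 (delta beta : R) :=
  moment delta (weight beta) (fun t : n.+1.-tuple T => tnorm t ^+ 6).

Lemma measurable_tnormX_weight k beta : measurable_fun setT
  (fun t : n.+1.-tuple T => tnorm t ^+ k * weight beta (tnorm t)).
Proof.
apply: measurable_funM; last exact: (measurable_weight (measurable_weight_fun _)).
by apply: measurable_funX; exact: measurable_tnorm.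
Qed.

Lemma tnormX_weight_ge0 k beta (t : n.+1.-tuple T) :
  0 <= tnorm t ^+ k * weight beta (tnorm t).
Proof. exact: mulr_ge0 (exprn_ge0 _ (tnorm_ge0 _)) (weight_ge0 _ _). Qed.

Lemma tnorm6_le (delta beta : R) (t : n.+1.-tuple T) : tball n.+1 delta t ->
  tnorm t ^+ 6 * weight beta (tnorm t) <=
  delta ^+ 2 * (tnorm t ^+ 4 * weight beta (tnorm t)).
Proof.
move=> Dt; rewrite (exprD _ 2 4) -mulrA ler_wpM2r ?tnormX_weight_ge0//.
by rewrite lerXn2r ?nnegrE ?tnorm_ge0 ?(le_trans (tnorm_ge0 t))// ltW.
Qed.

Lemma integrable_tnorm6 (delta beta : R) : beta < N + 2 -> 0 < delta ->
  mu.-integrable (tball n.+1 delta)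
    (EFin \o (fun t => tnorm t ^+ 6 * weight beta (tnorm t))).
Proof.
move=> bn d0; have i4 := integrable_weight bn d0.
apply: (@integrable_quartic _ _ _ _ i4 _ (delta ^+ 2)).
  exact: measurable_tnormX_weight.
by move=> t Dt; rewrite ger0_norm ?tnormX_weight_ge0// tnorm6_le.
Qed.

Lemma moment4_ge0 (delta beta : R) : 0 <= moment4 delta beta.
Proof. by apply: Rintegral_ge0 => t _; exact: tnormX_weight_ge0. Qed.

Lemma moment6_ge0 (delta beta : R) : 0 <= moment6 delta beta.
Proof. by apply: Rintegral_ge0 => t _; exact: tnormX_weight_ge0. Qed.

Lemma moment6_le (delta beta : R) : beta < N + 2 -> 0 < delta ->
  moment6 delta beta <= delta ^+ 2 * moment4 delta beta.
Proof.
move=> bn d0; have i4 := integrable_weight bn d0.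
rewrite /moment4 /moment -RintegralZl//; last exact: measurable_tball.
apply: le_Rintegral.
- exact: measurable_tball.
- exact: integrable_tnorm6.
- exact: (integrableZl (@measurable_tball R n.+1 delta) (delta ^+ 2) i4).
- by move=> t Dt; exact: tnorm6_le.
Qed.

Lemma tball_finite (delta : R) : 0 < delta -> (mu (tball n.+1 delta) < +oo)%E.
Proof.
move=> d0; apply: (@le_lt_trans _ _ (mu (cube delta))).
  apply: le_measure; rewrite ?inE.
  - exact: measurable_tball.
  - exact: measurable_cube.
  - by move=> t; exact: tball_cube.
by rewrite lebesgue_cube// ltry.
Qed.

(** Below radius [eps] the two extra powers give [eps ^+ 2]; above it the integrand is bounded. The
    second term must not depend on [beta], since [beta] tends to N + 2 with [eps] fixed. *)
Lemma moment6_split (delta beta eps : R) :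
  2 < beta < N + 2 -> 0 < delta -> 0 < eps <= 1 ->
  moment6 delta beta <= eps ^+ 2 * moment4 delta beta +
    delta ^+ 2 * eps `^ (- N) * fine (mu (tball n.+1 delta)).
Proof.
move=> /andP[b2 bn] d0 /andP[e0 e1]; have i4 := integrable_weight bn d0.
have mD := @measurable_tball R n.+1 delta.
have ic (c : R) : mu.-integrable (tball n.+1 delta) (EFin \o cst c).
  apply/integrableP; split.
    by apply/measurable_EFinP; exact: measurable_cst.
  rewrite [X in (X < _)%E](_ : _ = (`|c|%:E * mu (tball n.+1 delta))%E).
    by rewrite lte_mul_pinfty ?lee_fin//; exact: tball_finite.
  by rewrite -integral_cst.
rewrite -(Rintegral_cst mu mD) /moment4 /moment -RintegralZl//.
have i42 := integrableZl mD (eps ^+ 2) i4.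
rewrite -RintegralD//; last exact: ic.
apply: le_Rintegral => //; first exact: integrable_tnorm6.
  exact: integrableD i42 (ic _).
move=> t Dt; rewrite (exprD _ 2 4) -mulrA.
have te0 := tnormX_weight_ge0 4 beta t.
have [te|et] := ltP (tnorm t) eps.
  apply: ler_wpDr; first by rewrite mulr_ge0 ?sqr_ge0 ?powR_ge0.
  by rewrite ler_wpM2r// lerXn2r ?nnegrE ?tnorm_ge0// ltW.
apply: ler_wpDl; first by rewrite mulr_ge0 ?sqr_ge0.
have t0 : 0 < tnorm t by exact: lt_le_trans et.
apply: ler_pM => //; first exact: sqr_ge0.
  by rewrite lerXn2r ?nnegrE ?tnorm_ge0 ?(ltW d0)// ltW.
(* As 2 - beta is negative, the power is largest at [eps]; as [eps <= 1] and - N < 2 - beta, passing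
   to the exponent - N removes [beta]. *)
rewrite weight4//; apply: (@le_trans _ _ (eps `^ (2 - beta))); last first.
  by apply: ger_powR; [rewrite e0|lra].
rewrite -[2 - beta]opprK !(powRN _ (- _)) lef_pV2 ?posrE ?powR_gt0//.
by rewrite ge0_ler_powR ?nnegrE ?(ltW e0) ?(ltW t0)//; lra.
Qed.

(** Dividing by N puts the box of side bound [radius] within distance delta / 2^(k+1) of the origin,
    by the crude estimate sqrt N <= N. Since the radius halves with [k], the intervals defining the
    boxes are adjacent and the boxes disjoint. *)
Definition radius (delta : R) k : R := delta / 2 ^+ k.+1 / N.

Definition dyadic_box (delta : R) k : set (n.+1.-tuple T) :=
  box (fun _ => `]radius delta k / 2, radius delta k[%classic : set T).

Lemma radius_gt0 delta k : 0 < delta -> 0 < radius delta k.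
Proof. by move=> d0; rewrite !divr_gt0// exprn_gt0. Qed.

Lemma tnorm_dyadic_box delta k t : 0 < delta -> dyadic_box delta k t ->
  radius delta k / 2 < tnorm t <= delta / 2 ^+ k.+1.
Proof.
move=> d0 Qt; have r0 := radius_gt0 k d0; apply/andP; split.
  have := Qt ord0; rewrite /= in_itv/= => /andP[rt _].
  by rewrite (lt_le_trans rt)// (le_trans (ler_norm _))// normr_tnth_le.
have -> : delta / 2 ^+ k.+1 = N * radius delta k.
  by rewrite /radius [RHS]mulrC divfK// pnatr_eq0.
rewrite -(ler_pXn2r (n := 2)) ?nnegrE ?tnorm_ge0 ?(mulr_ge0 _ (ltW r0))//.
rewrite sqr_tnorm (@le_trans _ _ (\sum_(i < n.+1) radius delta k ^+ 2))//.
  apply: ler_sum => i _; have := Qt i; rewrite /= in_itv/= => /andP[rt tr].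
  by rewrite lerXn2r ?nnegrE ?ltW// (lt_trans _ rt)// divr_gt0.
rewrite sumr_const card_ord -[_ ^+ 2 *+ _]mulr_natl [leRHS]exprMn ler_wpM2r ?sqr_ge0//.
by rewrite expr2 ler_peMr// ler1n.
Qed.

Lemma dyadic_box_tball delta k : 0 < delta ->
  dyadic_box delta k `<=` tball n.+1 delta.
Proof.
move=> d0 t /(tnorm_dyadic_box d0) /andP[_ tk]; apply: (le_lt_trans tk).
by rewrite ltr_pdivrMr ?exprn_gt0// ltr_pMr// exprn_egt1// ltr1n.
Qed.

Lemma dyadic_box_disj delta j k t : 0 < delta ->
  dyadic_box delta j t -> dyadic_box delta k t -> j = k.
Proof.
move=> d0; wlog jk : j k / (j <= k)%N.
  by move=> W; have [/W//|/ltnW/W W' qj qk] := leqP j k; exact/esym/W'.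
move=> /(_ ord0) + /(_ ord0); rewrite /= !in_itv/= => /andP[jt _] /andP[_ tk].
apply/eqP; rewrite eqn_leq jk/= leqNgt; apply/negP => jltk.
have := lt_trans jt tk; apply/negP; rewrite -leNgt /radius [leRHS]mulrAC.
rewrite ler_wpM2r ?invr_ge0// -[leRHS]mulrA -invfM -exprSr ler_wpM2l ?(ltW d0)//.
by rewrite lef_pV2 ?posrE ?exprn_gt0// ler_eXn2l ?ltr1n.
Qed.

Lemma lebesgue_dyadic_box delta k : 0 < delta ->
  mu (dyadic_box delta k) = ((radius delta k / 2) ^+ n.+1)%:E.
Proof.
move=> d0; have r0 := radius_gt0 k d0.
rewrite /dyadic_box lebesgue_box; last by move=> i; exact: measurable_itv.
under eq_bigr do
  rewrite lebesgue_measure_itv/= lte_fin ltr_pdivrMr// ltr_pMr// ltr1n -EFinB.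
by rewrite prodEFin prodr_const card_ord; congr ((_ ^+ _)%:E); lra.
Qed.

(** The boxes being disjoint, at most one indicator is nonzero at each point, so the simple function
    with values [m k] lies below the integrand. *)
Lemma moment4_ge_sum (delta beta : R) (m : nat -> R) K :
  beta < N + 2 -> 0 < delta -> (forall k, 0 <= m k) ->
  (forall k t, dyadic_box delta k t ->
    m k <= tnorm t ^+ 4 * weight beta (tnorm t)) ->
  \sum_(k < K) m k * (radius delta k / 2) ^+ n.+1 <= moment4 delta beta.
Proof.
move=> bn d0 m0 mf; have i4 := integrable_weight bn d0.
have mD := @measurable_tball R n.+1 delta.
have mQ k : measurable (dyadic_box delta k).
  by apply: measurable_box => i; exact: measurable_itv.
pose h k t : \bar R := ((m k)%:E * (\1_(dyadic_box delta k) t)%:E)%E.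
have h0 k t : (0 <= h k t)%E by rewrite mule_ge0// lee_fin.
have m1 k : measurable_fun setT (fun t => (\1_(dyadic_box delta k) t)%:E).
  by apply/measurable_EFinP; apply: measurable_indic; exact: mQ.
have mh k : measurable_fun setT (h k) by exact: emeasurable_funM.
rewrite -lee_fin /moment4 /moment /Rintegral fineK; last first.
  exact: integrable_fin_num.
apply: (@le_trans _ _
    (\int[mu]_(t in tball n.+1 delta) \sum_(k < K) h k t)%E).
  rewrite ge0_integral_sum//; last by move=> k; exact: measurable_funTS.
  rewrite -sumEFin; apply: lee_sum => k _.
  rewrite ge0_integralZl_EFin//; last by apply: measurable_funTS; exact: m1.
  rewrite integral_indic// setIidl; last exact: dyadic_box_tball.
  by rewrite EFinM -lebesgue_dyadic_box.
apply: ge0_le_integral => //.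
- by move=> t _; exact: sume_ge0.
- by apply: emeasurable_sum => k; exact: measurable_funTS.
- apply/measurable_EFinP; apply: measurable_funTS.
  exact: measurable_tnormX_weight.
move=> t Dt; have [[j Qj]|nQ] := pselect (exists j : 'I_K, dyadic_box delta j t).
  rewrite (bigD1 j)//= big1 ?adde0; last first.
    move=> k kj; rewrite /h indicE memNset ?mule0// => Qk.
    by move: kj; rewrite -(inj_eq val_inj)/= (dyadic_box_disj d0 Qk Qj) eqxx.
  by rewrite /h indicE mem_set// mule1 lee_fin mf.
rewrite big1 ?lee_fin ?tnormX_weight_ge0// => k _.
by rewrite /h indicE memNset ?mule0// => Qk; apply: nQ; exists k.
Qed.

(** A single box suffices. The minimum in [m] takes the power at both ends of the range of norms, so
    that either sign of 2 - beta is covered. *)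
Lemma moment4_gt0 (delta beta : R) : beta < N + 2 -> 0 < delta ->
  0 < moment4 delta beta.
Proof.
move=> bn d0; pose p := 2 - beta.
pose m k := Num.min ((radius delta k / 2) `^ p) ((delta / 2 ^+ k.+1) `^ p).
have m_gt0 k : 0 < m k.
  by rewrite lt_min !powR_gt0// divr_gt0 ?exprn_gt0 ?radius_gt0.
apply: lt_le_trans (@moment4_ge_sum _ _ m 1 bn d0 _ _).
- by rewrite big_ord1 mulr_gt0// exprn_gt0// divr_gt0// radius_gt0.
- by move=> k; exact: ltW.
move=> k t /(tnorm_dyadic_box d0) /andP[rt tr].
have r0 := radius_gt0 k d0.
have r20 : 0 < radius delta k / 2 by rewrite divr_gt0.
have t0 : 0 < tnorm t by exact: lt_trans rt.
have dk : 0 < delta / 2 ^+ k.+1 by exact: lt_le_trans tr.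
rewrite weight4// ge_min; apply/orP; have [p0|p0] := leP 0 p; [left|right].
  by rewrite (ge0_ler_powR p0) ?nnegrE ?(ltW t0) ?(ltW r20) ?(ltW rt).
rewrite -/p -[p]opprK !(powRN _ (- p)) lef_pV2 ?posrE ?powR_gt0//.
by rewrite ge0_ler_powR ?nnegrE ?(ltW t0) ?(ltW dk)// oppr_ge0 ltW.
Qed.

(** With c_k = delta / 2^(k+1), box [k] has volume (2N)^-N c_k^N and the integrand is at least
    c_k^(2 - beta) on it. Each of the [K] contributions is thus at least the one at scale delta /
    2^K, a bound whose power tends to 1 at the critical exponent. *)
Lemma moment4_lower (delta beta : R) K : 2 < beta < N + 2 -> 0 < delta ->
  K%:R * ((2 * N) ^- n.+1 * (delta / 2 ^+ K) `^ (N + 2 - beta)) <=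
  moment4 delta beta.
Proof.
move=> /andP[b2 bn] d0.
pose m k : R := (delta / 2 ^+ k.+1) `^ (2 - beta).
apply: le_trans (@moment4_ge_sum _ _ m K bn d0 _ _).
- rewrite mulr_natl -[X in _ *+ X]card_ord -sumr_const; apply: ler_sum => k _.
  have dk : 0 < delta / 2 ^+ k.+1 by rewrite divr_gt0 ?exprn_gt0.
  have -> : radius delta k / 2 = (2 * N)^-1 * (delta / 2 ^+ k.+1).
    by rewrite /radius invfM; ring.
  rewrite [((2 * N)^-1 * _) ^+ _]exprMn exprVn [leRHS]mulrCA.
  rewrite ler_wpM2l ?invr_ge0 ?exprn_ge0 ?mulr_ge0//.
  rewrite -(@powR_mulrn _ _ n.+1 (ltW dk)) -powRD; last by rewrite (gt_eqF dk) implybT.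
  rewrite (_ : 2 - beta + N = N + 2 - beta); last by ring.
  rewrite ge0_ler_powR ?nnegrE ?(ltW dk)//.
  + by rewrite subr_ge0 ltW.
  + by rewrite divr_ge0 ?exprn_ge0// ltW.
  + rewrite ler_wpM2l ?(ltW d0)// lef_pV2 ?posrE ?exprn_gt0//.
    by rewrite ler_eXn2l ?ltr1n.
- by move=> k; exact: powR_ge0.
move=> k t /(tnorm_dyadic_box d0) /andP[rt tr].
have r0 := radius_gt0 k d0.
have t0 : 0 < tnorm t by apply: lt_trans rt; rewrite divr_gt0.
have dk : 0 < delta / 2 ^+ k.+1 by exact: lt_le_trans tr.
rewrite /m weight4// -[2 - beta]opprK !(powRN _ (- (2 - beta))).
rewrite lef_pV2 ?posrE ?powR_gt0//.
by rewrite ge0_ler_powR ?nnegrE ?(ltW t0) ?(ltW dk)//; lra.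
Qed.

End even_moments.


(** * Convergence of the multipliers *)

Lemma cvg_mx {R : realType} {X : Type} {F : set_system X} {FF : Filter F}
    (m n : nat) (f : X -> 'M[R]_(m, n)) (l : 'M[R]_(m, n)) :
  (forall i j, f x i j @[x --> F] --> l i j) -> f x @[x --> F] --> l.
Proof.
move=> fl; apply/cvg_ballP => e e0.
have H : \forall x \near F, forall ij : 'I_m * 'I_n,
    ball (l ij.1 ij.2) e (f x ij.1 ij.2).
  by apply: filter_forall => ij; exact: (cvg_ball (fl ij.1 ij.2)).
by apply: filterS H => x H; split=> // i j; exact: (H (i, j)).
Qed.

Lemma cvg_of_bound {R : realType} {X : Type} {F : set_system X} {FF : Filter F}
    (f rho : X -> R) (l K : R) :
  rho x @[x --> F] --> 0 -> (\forall x \near F, `|f x - l| <= K * rho x) ->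
  f x @[x --> F] --> l.
Proof.
move=> rho0 fl.
have Kr : K * rho x @[x --> F] --> 0.
  by rewrite -[X in _ --> X](mulr0 K); apply: cvgM => //; exact: cvg_cst.
apply: (@squeeze_cvgr _ _ _ _ (fun x => l - K * rho x) (fun x => l + K * rho x)).
- by apply: filterS fl => x; rewrite ler_distl.
- by rewrite -[X in _ --> X]subr0; apply: cvgB => //; exact: cvg_cst.
- by rewrite -[X in _ --> X]addr0; apply: cvgD => //; exact: cvg_cst.
Qed.

(** [pochhammer 0 k] contains the factor 0 as soon as k >= 1, so only the term of index 0
    survives. *)
Lemma hypergeometric_numerator0 {R : realType} (a b : seq R) (z : R) :
  0 \in a -> hypergeometric a b z = 1.
Proof.
move=> a0; apply: cvg_lim => //; apply: cvg_near_cst.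
(* [series] at index 0 is the empty sum, so the partial sums equal 1 only from index 1 on. *)
exists 1%N => // -[//|k] _.
rewrite /series/= big_nat_recl//= [X in _ + X]big1 ?addr0.
  by rewrite !big1 ?expr0 ?fact0 ?divr1 ?mulr1// => x _;
    rewrite /pochhammer big_ord0.
move=> i _; rewrite (big_rem 0)//= {1}/pochhammer big_ord_recl/= addr0.
by rewrite !mul0r.
Qed.

(** * The ratio J / I and the error bounds for the multipliers *)

Section taylor_estimates.
Context {R : realType} (n : nat).
Local Notation T := (measurableTypeR R).
Local Notation N := (n.+1%:R : R).
Local Notation mu := (lebesgue_tuple n.+1).
Implicit Types (delta beta : R) (nu : 'rV[R]_n.+1).

Lemma moment4_unbounded delta (A : R) : 0 < delta ->
  \forall beta \near (N + 2)^'-, A <= moment4 n delta beta.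
Proof.
move=> d0; pose c : R := (2 * N) ^- n.+1.
have c0 : 0 < c by rewrite invr_gt0 exprn_gt0 ?mulr_gt0.
(* The factor 2 offsets the lower bound 1/2 that the power satisfies near the critical exponent. *)
pose K := (Num.truncn (2 * A / c)).+1.
have AK : 2 * A / c < K%:R by exact: truncnS_gt.
have AKc : A <= K%:R * (c * (1 / 2)).
  by move: AK; rewrite ltr_pdivrMr// => AK; lra.
pose b := delta / 2 ^+ K.
have b0 : 0 < b by rewrite divr_gt0 ?exprn_gt0.
have bcvg : b `^ (N + 2 - beta) @[beta --> (N + 2)^'-] --> (1 : R).
  apply: cvg_at_left_filter.
  rewrite [X in X @ _](_ : _ = expR \o (fun beta => (N + 2 - beta) * ln b)); last first.
    by apply/funext => beta; rewrite /powR (gt_eqF b0).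
  rewrite [X in _ --> X](_ : _ = expR ((N + 2 - (N + 2)) * ln b)); last first.
    by rewrite subrr mul0r expR0.
  apply: continuous_cvg; first exact: continuous_expR.
  apply: cvgM; last exact: cvg_cst.
  by apply: cvgB; [exact: cvg_cst|exact: cvg_id].
near=> beta.
apply: le_trans (@moment4_lower _ n _ beta K _ d0); last first.
  apply/andP; split; near: beta.
    by apply: nbhs_left_gt; rewrite ltrDr.
  exact: nbhs_left_lt.
have h : 1 / 2 <= b `^ (N + 2 - beta).
  near: beta; apply: (cvgr_ge _ bcvg); lra.
rewrite -/c -/b (le_trans AKc)//; rewrite ler_wpM2l// ler_wpM2l//; exact: ltW.
Unshelve. all: by end_near. Qed.

Lemma moment_ratio_cvg_beta delta : 0 < delta ->
  moment6 n delta beta / moment4 n delta beta @[beta --> (N + 2)^'-] --> 0.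
Proof.
move=> d0; apply/cvgrPdist_le => e e0.
(* Then [eps ^+ 2 <= eps <= e / 2]; the other half of [e] absorbs [C / moment4] once [moment4] is
   large. *)
pose eps := Num.min 1 (e / 2).
have eps0 : 0 < eps by rewrite lt_min ltr01 divr_gt0.
have eps1 : eps <= 1 by rewrite ge_min lexx.
have epse : eps ^+ 2 <= e / 2.
  have : eps <= e / 2 by rewrite ge_min lexx orbT.
  by nra.
pose C := delta ^+ 2 * eps `^ (- N) * fine (mu (tball n.+1 delta)).
near=> beta.
have bn : beta < N + 2 by near: beta; exact: nbhs_left_lt.
have b2 : 2 < beta by near: beta; apply: nbhs_left_gt; rewrite ltrDr.
have m4 := moment4_gt0 bn d0.
rewrite sub0r normrN ger0_norm ?divr_ge0 ?moment6_ge0 ?moment4_ge0//.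
rewrite ler_pdivrMr//.
have C4 : 2 * C / e <= moment4 n delta beta.
  by near: beta; exact: moment4_unbounded.
have : moment6 n delta beta <= eps ^+ 2 * moment4 n delta beta + C.
  by apply: moment6_split => //; [rewrite b2 bn|rewrite eps0 eps1].
move: C4; rewrite ler_pdivrMr// => C4 /le_trans; apply.
have : eps ^+ 2 * moment4 n delta beta <= e / 2 * moment4 n delta beta.
  by rewrite ler_wpM2r// ltW.
by lra.
Unshelve. all: by end_near. Qed.

Lemma moment_ratio_cvg_delta beta : beta < N + 2 ->
  moment6 n delta beta / moment4 n delta beta @[delta --> (0 : R)^'+] --> 0.
Proof.
move=> bn.
apply: (@cvg_of_bound _ _ _ _ _ (fun delta => delta ^+ 2) _ 1).
  apply: cvg_at_right_filter.
  by rewrite -[X in _ --> X](expr0n R 2); apply: exprn_continuous.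
near=> delta.
have d0 : 0 < delta by near: delta; exact: nbhs_right_gt.
have m4 := moment4_gt0 bn d0.
rewrite subr0 ger0_norm ?divr_ge0 ?moment6_ge0 ?moment4_ge0//.
by rewrite mul1r ler_pdivrMr// moment6_le.
Unshelve. all: by end_near. Qed.

Lemma weight2 beta (r : R) : 0 <= r -> r ^+ 2 / r `^ beta = r ^+ 4 * weight beta r.
Proof.
rewrite le_eqVlt => /predU1P[<-|r0]; first by rewrite !expr0n/= !mul0r.
rewrite /weight powRD ?(gt_eqF r0) ?implybT// invfM.
rewrite (@powR_mulrn _ _ 2 (ltW r0)); field.
by rewrite !gt_eqF// powR_gt0.
Qed.

Lemma scaling_constantE delta beta :
  scaling_constant n.+1 delta beta = 2 * N / moment4 n delta beta.
Proof.
rewrite /scaling_constant invfM invrK; congr (_ / _).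
by apply: eq_Rintegral => t _; exact/weight2/tnorm_ge0.
Qed.

(** [F] is written as the error, dominated by [K] times the integrand of [moment6], plus the
    integrand of the moment; both are integrable, so the integral splits. *)
Lemma approx_moment delta beta (F p : n.+1.-tuple T -> R) (K : R) :
  beta < N + 2 -> 0 < delta -> measurable_fun setT F ->
  quartic_bounded p ->
  (forall t, `|F t - p t * weight beta (tnorm t)| <=
     K * (tnorm t ^+ 6 * weight beta (tnorm t))) ->
  `|\int[mu]_(t in tball n.+1 delta) F t - moment delta (weight beta) p| <=
  K * moment6 n delta beta.
Proof.
move=> bn d0 mF qp FK.
have i4 := integrable_weight bn d0; have i6 := integrable_tnorm6 bn d0.
have mD := @measurable_tball R n.+1 delta.
have ip := integrable_moment (measurable_weight_fun beta) (weight_ge0 beta) i4 qp.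
have mFp : measurable_fun setT (fun t => F t - p t * weight beta (tnorm t)).
  apply: measurable_funB => //; apply: measurable_funM; first by case: qp.
  exact: (measurable_weight (measurable_weight_fun _)).
have iFp : mu.-integrable (tball n.+1 delta)
    (EFin \o (fun t => F t - p t * weight beta (tnorm t))).
  apply: (le_integrable mD _ _ (integrableZl mD K i6)).
    by apply/measurable_EFinP; exact: measurable_funTS.
  by move=> t Dt; rewrite /= lee_fin (le_trans (FK t))// ler_norm.
have -> : \int[mu]_(t in tball n.+1 delta) F t =
    \int[mu]_(t in tball n.+1 delta) (F t - p t * weight beta (tnorm t)) +
    moment delta (weight beta) p.
  by rewrite -RintegralD//; apply: eq_Rintegral => t _; rewrite subrK.
rewrite addrK (le_trans (le_normr_Rintegral mD iFp))//.
rewrite -RintegralZl//; apply: le_Rintegral => //.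
- exact: integrable_norm iFp.
- exact: (integrableZl mD K i6).
Qed.

(** Plays the part of the Euclidean norm in the Cauchy-Schwarz inequality: a coordinatewise estimate
    suffices, because only some constant depending on [nu] is wanted. *)
Definition l1norm nu : R := \sum_i `|nu 0 i|.

Lemma l1norm_ge0 nu : 0 <= l1norm nu.
Proof. by apply: sumr_ge0. Qed.

Lemma normr_dot_le nu (t : n.+1.-tuple T) :
  `|dotv nu (row_of_tuple t)| <= l1norm nu * tnorm t.
Proof.
rewrite /dotv (le_trans (ler_norm_sum _ _ _))// mulr_suml; apply: ler_sum => i _.
by rewrite normrM mxE ler_wpM2l// normr_tnth_le.
Qed.

Lemma normr_dot_leX k nu (t : n.+1.-tuple T) :
  `|dotv nu (row_of_tuple t)| ^+ k <= (l1norm nu * tnorm t) ^+ k.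
Proof.
by rewrite lerXn2r ?nnegrE ?mulr_ge0 ?l1norm_ge0 ?tnorm_ge0 ?normr_dot_le.
Qed.

Lemma normr_tnth2_le i j (t : n.+1.-tuple T) :
  `|tnth t i * tnth t j : R| <= tnorm t * tnorm t.
Proof. by rewrite normrM ler_pM ?normr_tnth_le. Qed.

(** The prefactor (N + 2) m 2N / I cancels I / (N (N + 2)) in [moment_dot2], leaving exactly the
    limit; the same prefactor turns the error J into J / I. *)
Lemma Mb_int_bound (m : R) delta beta nu i j : beta < N + 2 -> 0 < delta ->
  `|Mb_int m delta beta nu i j -
    ((- m * enorm nu ^+ 2) *: 1%:M - (2 * m) *: tensorv nu nu) i j| <=
  ((N + 2) * `|m| * (2 * N) * l1norm nu ^+ 4) *
  (moment6 n delta beta / moment4 n delta beta).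
Proof.
move=> bn d0; have m4 := moment4_gt0 bn d0.
have i4 := integrable_weight bn d0.
have mw := measurable_weight_fun beta; have w0 := weight_ge0 beta.
pose F (t : n.+1.-tuple T) := (cos (dotv nu (row_of_tuple t)) - 1) *
  weight beta (tnorm t) * (tnth t i * tnth t j).
pose q (t : n.+1.-tuple T) : R := tnth t i * tnth t j * dotv nu (row_of_tuple t) ^+ 2.
have qq : quartic_bounded q.
  split.
    apply: measurable_funM; first by apply: measurable_funM; exact: measurable_coord.
    by apply: measurable_funX; exact: measurable_dot.
  exists (l1norm nu ^+ 2) => t; rewrite /q normrM normrX.
  have -> : l1norm nu ^+ 2 * tnorm t ^+ 4 =
    tnorm t * tnorm t * (l1norm nu * tnorm t) ^+ 2 by ring.
  apply: ler_pM; rewrite ?exprn_ge0 ?normr_ge0 ?normr_tnth2_le//.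
  exact: normr_dot_leX.
have mF : measurable_fun setT F.
  apply: measurable_funM; last by apply: measurable_funM; exact: measurable_coord.
  apply: measurable_funM; last exact: (measurable_weight mw).
  apply: measurable_funB => //.
  apply: (measurableT_comp _ (measurable_dot nu)).
  by apply: continuous_measurable_fun; exact: continuous_cos.
(* The quadratic Taylor term of cos - 1 is the source of the factor - 1/2. *)
have bound := approx_moment (F := F) (p := fun t => - 2^-1 * q t)
  (K := l1norm nu ^+ 4) bn d0 mF (quartic_boundedZ _ qq) _.
have {bound} : `|\int[mu]_(t in tball n.+1 delta) F t + 2^-1 *
    (moment4 n delta beta / (N * (N + 2)) *
     ((i == j)%:R * dotv nu nu + 2 * (nu 0 i * nu 0 j)))| <=
    l1norm nu ^+ 4 * moment6 n delta beta.
  rewrite -(moment_dot2 mw w0 i4) -[X in `|_ + X|]opprK -mulNr.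
  rewrite -(momentZ mw w0 i4)//; apply: bound => t.
  have -> : F t - - 2^-1 * q t * weight beta (tnorm t) =
      (cos (dotv nu (row_of_tuple t)) - 1 + dotv nu (row_of_tuple t) ^+ 2 / 2) *
      (tnth t i * tnth t j) * weight beta (tnorm t) by rewrite /F /q; ring.
  rewrite normrM (ger0_norm (w0 _)) [leRHS]mulrA ler_wpM2r// normrM.
  have -> : l1norm nu ^+ 4 * tnorm t ^+ 6 =
    (l1norm nu * tnorm t) ^+ 4 * (tnorm t * tnorm t) by ring.
  apply: ler_pM; rewrite ?normr_ge0 ?normr_tnth2_le//.
  rewrite (le_trans (cos_taylor_bound _))// (le_trans (ler_norm _))// normrX.
  exact: normr_dot_leX.
have E : Mb_int m delta beta nu i j =
    (N + 2) * m * (2 * N / moment4 n delta beta) *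
    \int[mu]_(t in tball n.+1 delta) F t.
  rewrite /Mb_int !mxE scaling_constantE; congr (_ * _).
  by apply: eq_Rintegral => t _; rewrite !mxE.
have nn : enorm nu ^+ 2 = dotv nu nu.
  by rewrite sqr_sqrtr// sumr_ge0// => k _; rewrite -expr2 sqr_ge0.
have N0 : N != 0 by rewrite pnatr_eq0.
have N2 : N + 2 != 0 by rewrite -natrD pnatr_eq0.
have m40 : moment4 n delta beta != 0 by rewrite gt_eqF.
rewrite E !mxE nn; set I := (\int[mu]_(t in _) _).
have -> : (N + 2) * m * (2 * N / moment4 n delta beta) * I -
    (- m * dotv nu nu * (i == j)%:R - 2 * m * (nu 0 i * nu 0 j)) =
    (N + 2) * m * (2 * N) / moment4 n delta beta * (I + 2^-1 *
    (moment4 n delta beta / (N * (N + 2)) *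
     ((i == j)%:R * dotv nu nu + 2 * (nu 0 i * nu 0 j)))).
  move: N0 N2 m40; move: N (moment4 _ _ _) => u v u0 u2 v0.
  by field; rewrite u0 v0 u2.
rewrite normrM => h.
have -> : (N + 2) * `|m| * (2 * N) * l1norm nu ^+ 4 *
    (moment6 n delta beta / moment4 n delta beta) =
    `|(N + 2) * m * (2 * N) / moment4 n delta beta| *
    (l1norm nu ^+ 4 * moment6 n delta beta).
  rewrite !normrM normfV (ger0_norm (ltW m4)) (@ger0_norm _ (N + 2)) ?addr_ge0//.
  by rewrite (@ger0_norm _ 2)// (@ger0_norm _ N)//; ring.
exact: ler_wpM2l.
Qed.

(** The coefficient c^2 / 4 of the tensor square is shared equally between its two factors; the
    vector so normalised tends to [nu]. *)
Lemma Ms_vector_bound delta beta nu i : beta < N + 2 -> 0 < delta ->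
  `|scaling_constant n.+1 delta beta / 2 *
    rV_integral (eball n.+1 delta) (fun w =>
      sin (dotv nu w) / enorm w `^ beta * w 0 i) - nu 0 i| <=
  (N * l1norm nu ^+ 3) * (moment6 n delta beta / moment4 n delta beta).
Proof.
move=> bn d0; have m4 := moment4_gt0 bn d0.
have i4 := integrable_weight bn d0.
have mw := measurable_weight_fun beta; have w0 := weight_ge0 beta.
pose F (t : n.+1.-tuple T) : R := sin (dotv nu (row_of_tuple t)) *
  (tnorm t ^+ 2 * weight beta (tnorm t)) * tnth t i.
pose q (t : n.+1.-tuple T) : R := tnth t i * dotv nu (row_of_tuple t) * tnorm t ^+ 2.
have qq : quartic_bounded q.
  split.
    apply: measurable_funM; last by apply: measurable_funX; exact: measurable_tnorm.
    by apply: measurable_funM; [exact: measurable_coord|exact: measurable_dot].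
  exists (l1norm nu) => t; rewrite /q 2!normrM normrX (ger0_norm (tnorm_ge0 t)).
  have -> : l1norm nu * tnorm t ^+ 4 =
    tnorm t * (l1norm nu * tnorm t) * tnorm t ^+ 2 by ring.
  apply: ler_wpM2r; first by rewrite exprn_ge0 ?tnorm_ge0.
  by apply: ler_pM; rewrite ?normr_ge0 ?normr_tnth_le ?normr_dot_le.
have mF : measurable_fun setT F.
  apply: measurable_funM; last exact: measurable_coord.
  apply: measurable_funM; last exact: measurable_tnormX_weight.
  apply: (measurableT_comp _ (measurable_dot nu)).
  by apply: continuous_measurable_fun; exact: continuous_sin.
have bound := approx_moment (F := F) (p := q) (K := l1norm nu ^+ 3) bn d0 mF qq _.
have {bound} : `|\int[mu]_(t in tball n.+1 delta) F t -
    moment4 n delta beta / N * nu 0 i| <= l1norm nu ^+ 3 * moment6 n delta beta.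
  rewrite -(moment_dot1 mw w0 i4); apply: bound => t.
  have -> : F t - q t * weight beta (tnorm t) =
      (sin (dotv nu (row_of_tuple t)) - dotv nu (row_of_tuple t)) *
      tnth t i * (tnorm t ^+ 2 * weight beta (tnorm t)) by rewrite /F /q; ring.
  rewrite normrM (ger0_norm (tnormX_weight_ge0 _ _ _)) normrM.
  have -> : l1norm nu ^+ 3 * (tnorm t ^+ 6 * weight beta (tnorm t)) =
    (l1norm nu * tnorm t) ^+ 3 * tnorm t * (tnorm t ^+ 2 * weight beta (tnorm t)).
    by ring.
  apply: ler_wpM2r; first exact: tnormX_weight_ge0.
  apply: ler_pM; rewrite ?normr_ge0 ?normr_tnth_le//.
  by rewrite (le_trans (sin_taylor_bound _))// normr_dot_leX.
have -> : rV_integral (eball n.+1 delta) (fun w =>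
      sin (dotv nu w) / enorm w `^ beta * w 0 i) =
    \int[mu]_(t in tball n.+1 delta) F t.
  apply: eq_Rintegral => t _; rewrite mxE /F.
  (* Away from the origin the two forms of the weight agree; at the origin they may differ, but the
     coordinate kills both sides. *)
  have := tnorm_ge0 t; rewrite le_eqVlt => /predU1P[t0|t0].
    have -> : tnth t i = 0 :> R.
      by apply/eqP; rewrite -normr_le0 t0 normr_tnth_le.
    by rewrite !mulr0.
  congr (_ * _ * _); apply: (mulfI (x := tnorm t ^+ 2)).
    by rewrite gt_eqF ?exprn_gt0.
  by rewrite mulrA -exprD -weight2 ?ltW.
rewrite scaling_constantE; set I := (\int[mu]_(t in _) _) => h.
have N0 : N != 0 by rewrite pnatr_eq0.
have m40 : moment4 n delta beta != 0 by rewrite gt_eqF.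
have -> : 2 * N / moment4 n delta beta / 2 * I - nu 0 i =
    N / moment4 n delta beta * (I - moment4 n delta beta / N * nu 0 i).
  move: N0 m40; move: N (moment4 _ _ _) => u v u0 v0.
  by field; rewrite u0 v0.
rewrite normrM (ger0_norm (divr_ge0 _ (ltW m4)))//.
have -> : N * l1norm nu ^+ 3 * (moment6 n delta beta / moment4 n delta beta) =
  N / moment4 n delta beta * (l1norm nu ^+ 3 * moment6 n delta beta) by ring.
by rewrite ler_wpM2l// divr_ge0// ltW.
Qed.

End taylor_estimates.


(** * Passage to the limit *)

Section limits.
Context {R : realType} (n : nat) (mu lambda : R) (nu : 'rV[R]_n.+1).
Local Notation N := (n.+1%:R : R).
Local Notation Mb_limit :=
  ((- mu * enorm nu ^+ 2) *: 1%:M - (2 * mu) *: tensorv nu nu).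
Local Notation Ms_limit := (- (lambda - mu) *: tensorv nu nu).

Lemma Mb_critical delta : Mb mu delta (N + 2) nu = Mb_limit.
Proof.
rewrite /Mb ltxx /Mb_hyp subrr mul0r.
by rewrite !hypergeometric_numerator0 ?inE ?eqxx ?orbT ?mulr1.
Qed.

Lemma Ms_critical delta : Ms mu lambda delta (N + 2) nu = Ms_limit.
Proof.
rewrite /Ms ltxx /Ms_hyp subrr mul0r.
by rewrite hypergeometric_numerator0 ?inE ?eqxx // expr1n mulr1.
Qed.

Lemma Ms_intE delta beta i j :
  let u k := scaling_constant n.+1 delta beta / 2 *
    rV_integral (eball n.+1 delta) (fun w =>
      sin (dotv nu w) / enorm w `^ beta * w 0 k) in
  Ms_int mu lambda delta beta nu i j = - (lambda - mu) * (u i * u j).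
Proof.
move=> u.
have sE k : (mx_integral (eball n.+1 delta) (fun w =>
    (sin (dotv nu w) / enorm w `^ beta) *: w) : 'rV[R]_n.+1) 0 k =
    rV_integral (eball n.+1 delta) (fun w =>
      sin (dotv nu w) / enorm w `^ beta * w 0 k).
  by rewrite mxE; apply: eq_Rintegral => t _; rewrite mxE.
by rewrite /Ms_int mxE [tensorv _ _ _ _]mxE !sE /u; field.
Qed.

(** Stated along an arbitrary filter because the bounds depend on [delta] and [beta] only through J
    / I; the two limits are instances with one of the functions constant. *)
Lemma multipliers_cvg {X : Type} {F : set_system X} {FF : Filter F}
    (delta beta : X -> R) :
  (\forall x \near F, 0 < delta x /\ beta x < N + 2) ->
  moment6 n (delta x) (beta x) / moment4 n (delta x) (beta x) @[x --> F] --> 0 ->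
  Mb mu (delta x) (beta x) nu @[x --> F] --> Mb_limit /\
  Ms mu lambda (delta x) (beta x) nu @[x --> F] --> Ms_limit.
Proof.
move=> Fdb rho0; split; apply: cvg_mx => i j.
  apply: (cvg_of_bound (f := fun x => Mb mu (delta x) (beta x) nu i j)
    (K := (N + 2) * `|mu| * (2 * N) * l1norm nu ^+ 4) rho0).
  by apply: filterS Fdb => x [d0 bn]; rewrite /Mb bn; exact: Mb_int_bound.
pose u k x := scaling_constant n.+1 (delta x) (beta x) / 2 *
    rV_integral (eball n.+1 (delta x)) (fun w =>
      sin (dotv nu w) / enorm w `^ beta x * w 0 k).
have ucvg k : u k x @[x --> F] --> nu 0 k.
  apply: (cvg_of_bound (K := N * l1norm nu ^+ 3) rho0).
  by apply: filterS Fdb => x [d0 bn]; exact: Ms_vector_bound.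
have -> : Ms_limit i j = - (lambda - mu) * (nu 0 i * nu 0 j) by rewrite !mxE.
apply: cvg_trans (cvgM (cvg_cst (- (lambda - mu))) (cvgM (ucvg i) (ucvg j))).
(* The integral formula for [Ms] holds only where [beta x < N + 2], that is, eventually. *)
apply: near_eq_cvg; apply: filterS Fdb => x [d0 bn].
by rewrite /Ms bn Ms_intE.
Qed.

Lemma Mb_limit_add_Ms_limit : Mb_limit + Ms_limit =
  - (lambda + mu) *: tensorv nu nu - (mu * enorm nu ^+ 2) *: 1%:M.
Proof. by apply/matrixP => i j; rewrite !mxE; ring. Qed.

Lemma peridynamic_cvg {X : Type} {F : set_system X} {FF : Filter F}
    (delta beta : X -> R) :
  Mb mu (delta x) (beta x) nu @[x --> F] --> Mb_limit /\
    Ms mu lambda (delta x) (beta x) nu @[x --> F] --> Ms_limit ->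
  [/\ Mb mu (delta x) (beta x) nu @[x --> F] --> Mb_limit,
      Ms mu lambda (delta x) (beta x) nu @[x --> F] --> Ms_limit &
      peridynamic_multiplier mu lambda (delta x) (beta x) nu @[x --> F] -->
        - (lambda + mu) *: tensorv nu nu - (mu * enorm nu ^+ 2) *: 1%:M].
Proof. by move=> [cb cs]; split=> //; rewrite -Mb_limit_add_Ms_limit; exact: cvgD. Qed.

End limits.

Theorem proposition4 (R : realType) (n : nat) (n_ge1 : (1 <= n)%N)
    (mu lambda : R) (nu : 'rV[R]_n) :
  [/\ (forall beta : R, beta <= n%:R + 2 ->
        [/\ Mb mu delta beta nu @[delta --> (0 : R)^'+] -->
              (- mu * enorm nu ^+ 2) *: 1%:M - (2 * mu) *: tensorv nu nu,
            Ms mu lambda delta beta nu @[delta --> (0 : R)^'+] -->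
              - (lambda - mu) *: tensorv nu nu &
            peridynamic_multiplier mu lambda delta beta nu
                @[delta --> (0 : R)^'+] -->
              - (lambda + mu) *: tensorv nu nu - (mu * enorm nu ^+ 2) *: 1%:M]),
      (forall delta : R, 0 < delta ->
        [/\ Mb mu delta beta nu @[beta --> (n%:R + 2 : R)^'-] -->
              (- mu * enorm nu ^+ 2) *: 1%:M - (2 * mu) *: tensorv nu nu,
            Ms mu lambda delta beta nu @[beta --> (n%:R + 2 : R)^'-] -->
              - (lambda - mu) *: tensorv nu nu &
            peridynamic_multiplier mu lambda delta beta nu
                @[beta --> (n%:R + 2 : R)^'-] -->
              - (lambda + mu) *: tensorv nu nu - (mu * enorm nu ^+ 2) *: 1%:M]) &
      - (lambda + mu) *: tensorv nu nu - (mu * enorm nu ^+ 2) *: 1%:M =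
        navier_multiplier mu lambda nu].
Proof.
case: n n_ge1 nu => // n _ nu; split=> // [beta|delta d0].
  rewrite le_eqVlt => /predU1P[->|bn].
    (* At the critical exponent both multipliers are constant in [delta]. *)
    apply: peridynamic_cvg; split.
      by under eq_fun do rewrite Mb_critical; exact: cvg_cst.
    by under eq_fun do rewrite Ms_critical; exact: cvg_cst.
  apply: (peridynamic_cvg (beta := fun=> beta)).
  apply: multipliers_cvg; last exact: moment_ratio_cvg_delta.
  by near=> delta; split=> //; near: delta; exact: nbhs_right_gt.
apply: (peridynamic_cvg (delta := fun=> delta)).
apply: multipliers_cvg; last exact: moment_ratio_cvg_beta.
by near=> beta; split=> //; near: beta; exact: nbhs_left_lt.
Unshelve. all: by end_near. Qed.
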